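(* Let $\eta_t(\omega)$ be the random walk in random environment built from $\delta\in(0,1/2)$, $\alpha>0$ and the i.i.d. vectors $(\xi_i,Y_i)$ as described in the context. Suppose $\mathbb{E}[\zeta_1]=0$, $s^2\in(0,\infty)$, $\lambda<0$, $\sigma^2\in[0,\infty)$ and $\alpha\in(0,1/2)$. Then, for $\mathbb{P}$-a.e. $\omega$, for any $\varepsilon>0$, we have $P$-a.s. that $$(\log\log t)^{-(1/\alpha)-\varepsilon} < \frac{\eta_t(\omega)}{(\log t)^{1/\alpha}} < (\log\log t)^{(2/\alpha)+\varepsilon}$$ for all but finitely many $t$.
   Context: Environment. Fix $\delta\in(0,1/2)$ and $\alpha>0$. Let $(\xi_i,Y_i)$, $i\in\mathbb{N}=\{1,2,\dots\}$, be i.i.d. random vectors on a probability space $(\Omega,\mathcal{F},\mathbb{P})$ (with expectation $\mathbb{E}$ and variance $\mathrm{Var}$) such that $\mathbb{P}[\delta\le\xi_1\le 1-\delta]=1$ and $Y_1$ takes values in $[-1,1]$; $\xi_1$ and $Y_1$ may be dependent. Set $p_0=q_0=1/2$ and, for $n\ge1$, let $p_n$ be the truncation of $\xi_n+Y_nn^{-\alpha}$ to $[\delta/2,1-\delta/2]$, i.e. $p_n=\xi_n+Y_nn^{-\alpha}$ if this lies in $[\delta/2,1-\delta/2]$, $p_n=\delta/2$ if $\xi_n+Y_nn^{-\alpha}<\delta/2$, and $p_n=1-\delta/2$ if $\xi_n+Y_nn^{-\alpha}>1-\delta/2$; let $q_n=1-p_n$. The environment is $\omega=(p_0,p_1,p_2,\dots)$.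 Walk. Given $\omega$, $(\eta_t(\omega);t\in\mathbb{Z}^+)$, $\mathbb{Z}^+=\{0,1,2,\dots\}$, is the Markov chain on $\mathbb{Z}^+$ under the quenched probability $P$ (depending on $\omega$), with $\eta_0(\omega)=r$ for some fixed $r\in\mathbb{Z}^+$ and transition probabilities: from $n\ge1$, to $n-1$ with probability $p_n$ and to $n+1$ with probability $q_n$; from $0$, to $0$ with probability $p_0$ and to $1$ with probability $q_0$. Notation. $\zeta_n=\log\left(\frac{\xi_n}{1-\xi_n}\right)$, $Z_n=\frac{Y_n}{\xi_n(1-\xi_n)}$, $\lambda=\mathbb{E}[Z_1]$, $s^2=\mathrm{Var}[\xi_1]$, $\sigma^2=\mathrm{Var}[Y_1]$. *)

(* Defs.v *)
From HB Require Import structures.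
From mathcomp Require Import all_boot all_order all_algebra finmap.
From mathcomp Require Import all_classical all_reals all_analysis.

Set Implicit Arguments.
Unset Strict Implicit.
Unset Printing Implicit Defensive.

Import Order.TTheory GRing.Theory Num.Theory.
Import numFieldNormedType.Exports.

Local Open Scope classical_set_scope.
Local Open Scope ring_scope.

Section iid.
Context d d' (T : measurableType d) (T' : measurableType d') (R : realType)
  (P : probability T R).

Definition mutually_independent (I : choiceType) (X : I -> T -> T') : Prop :=
  forall (J : {fset I}) (A : I -> set T'), (forall i, measurable (A i)) ->
    P (\bigcap_(i in [set` J]) X i @^-1` A i) =
    (\prod_(i <- J) P (X i @^-1` A i))%E.

Definition identically_distributed (I : Type) (X : I -> T -> T') : Prop :=
  forall (i j : I) (A : set T'), measurable A ->
    P (X i @^-1` A) = P (X j @^-1` A).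

Definition iid (I : choiceType) (X : I -> T -> T') : Prop :=
  mutually_independent X /\ identically_distributed X.

End iid.

Section environment.
Context (T : Type) (R : realType).
Implicit Types (delta alpha : R) (xi Y : nat -> T -> R) (n : nat).

Definition truncate (a b x : R) : R :=
  if x < a then a else if b < x then b else x.

(* [environment delta alpha xi Y w n] is $p_n$; the values [xi 0] and [Y 0]
   are never used, since the random vectors are indexed from 1. *)
Definition environment delta alpha xi Y (w : T) n : R :=
  if n is 0%N then 2^-1
  else truncate (delta / 2) (1 - delta / 2)
         (xi n w + Y n w * n%:R `^ (- alpha)).

Definition zeta xi n (w : T) : R := ln (xi n w / (1 - xi n w)).

Definition Zdrift xi Y n (w : T) : R := Y n w / (xi n w * (1 - xi n w)).

End environment.

Section walk.
Context (R : realType).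

(* [p n] is the probability of a step to the left from [n] when [0 < n], and
   [p 0] is the probability of staying at 0. *)
Definition transition (p : nat -> R) (i j : nat) : R :=
  if i is n.+1 then
    if j == n then p n.+1 else if j == n.+2 then 1 - p n.+1 else 0
  else
    if j == 0%N then p 0%N else if j == 1%N then 1 - p 0%N else 0.

(* The Markov property is in product form, so that it says nothing about
   histories of probability 0. *)
Definition markov_chain d (T : measurableType d) (P : probability T R)
    (K : nat -> nat -> R) (r : nat) (eta : nat -> {RV P >-> nat}) : Prop :=
  P [set x | eta 0%N x = r] = 1%E /\
  forall (t : nat) (i : nat -> nat),
    P [set x | forall s, (s <= t.+1)%N -> eta s x = i s] =
    (P [set x | forall s, (s <= t)%N -> eta s x = i s] *
     (K (i t) (i t.+1))%:E)%E.

End walk.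

(* Main.v *)
(* The environment enters through the potential V(n) = sum_(k <= n) ln (p_k / q_k),
   whose increments have mean of order -k^(-alpha) and variance bounded below.
   Almost surely, up to site n the potential never climbs by more than
   C n^alpha ln n, it falls by at least c n^(1 - alpha) between n and 2n, and it
   climbs at least once by c n^alpha: the first two facts are exponential
   Chebyshev bounds, and for the third the exponential of the draw-up process is a
   submartingale that has to cross the level.
   In such an environment the hitting time of n is at most exp (C' n^alpha ln n),
   by an explicit formula for its mean, and at least exp (c' n^alpha), since the
   walk has to cross the barrier; moreover the walk does not return from 2n to n
   before a time much larger than the hitting time of 2n + 2, because
   1 - alpha > alpha. Borel-Cantelli turns these estimates into the theorem. *)

(* The walk is given only by its cylinder probabilities, so no stopping times are formed on its
   space: every event needed says that the walk stays in prescribed sets up to a deterministic time,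
   and its probability is a finite recursion, compared with explicit functions built from exp V. The
   scale n^alpha is where drift and noise of the potential balance: for an exponential parameter t
   of order n^(-alpha), the drift term t n^(-alpha) and the variance term t^2 in the log-moments
   have the same order, and the constant in t decides whether exp (t V) is a supermartingale (upper
   bound on climbs) or a strict submartingale (lower bound). The union bound over pairs of sites
   costs the factor ln n in the largest climb; this logarithm, raised to the power 1/alpha, is what
   appears in the lower bound for the walk. The assumption alpha < 1/2 enters because n^(1 - 2
   alpha) must beat ln n: it is the order of the exponent in the deviation estimates over n sites,
   and the ratio of the fall between n and 2n to the scale n^alpha of the climbs. *)
Require Import Defs.
From mathcomp Require Import all_boot all_order all_algebra finmap.
From mathcomp Require Import all_classical all_reals all_analysis.
From mathcomp Require Import measurable_realfun zify ring lra.

Import Order.TTheory GRing.Theory Num.Theory.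
Import numFieldNormedType.Exports.
Local Open Scope classical_set_scope.
Local Open Scope ring_scope.

Set Implicit Arguments.
Unset Strict Implicit.
Unset Printing Implicit Defensive.

(** * The walk in a fixed environment *)

Section stay_probability.
Context (R : realType) (p : nat -> R).

(** Since [0.-1] is [0], the same formula covers the origin, where [p 0] is the probability of
    staying. *)
Definition step (f : nat -> R) (x : nat) : R :=
  p x * f x.-1 + (1 - p x) * f x.+1.

(* The probability that the walk started at [x] is in [B u] at every time
   [u <= k]. *)
Fixpoint stay_prob k (B : nat -> pred nat) (x : nat) : R :=
  (B 0%N x)%:R *
  (if k is k'.+1 then step (stay_prob k' (fun u => B u.+1)) x else 1).

Lemma transition_left x : transition p x x.-1 = p x.
Proof. by case: x => [|x] //=; rewrite eqxx. Qed.

Lemma transition_right x : transition p x x.+1 = 1 - p x.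
Proof. by case: x => [|x] //=; rewrite (gtn_eqF (leqnSn _)) eqxx. Qed.

Context d (T : measurableType d) (P : probability T R) (r : nat)
  (eta : nat -> {RV P >-> nat}).
Hypothesis eta_mc : markov_chain (transition p) r eta.

Lemma measurable_forall_nat (Q : nat -> nat -> Prop) (D : nat -> Prop)
    (g : nat -> nat) :
  measurable [set x | forall s, D s -> Q s (eta (g s) x)].
Proof.
rewrite (_ : [set _ | _] =
  \bigcap_(s in [set s | D s]) (eta (g s) @^-1` [set j | Q s j])).
  apply: bigcap_measurableType => s _.
  by rewrite -[X in measurable X]setTI; exact: measurable_funPT.
by apply/seteqP; split.
Qed.

Let cyl t (i : nat -> nat) : set T :=
  [set x | forall s, (s <= t)%N -> eta s x = i s].

Let extend t (i : nat -> nat) y s := if (s <= t)%N then i s else y.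

Let mcyl t i : measurable (cyl t i).
Proof. exact: (measurable_forall_nat (fun s j => j = i s)). Qed.

Let cyl_extend t i y :
  cyl t.+1 (extend t i y) = cyl t i `&` (eta t.+1 @^-1` [set y]).
Proof.
apply/seteqP; split => x /=.
  move=> h; split; last by rewrite h // /extend ltnn.
  by move=> s st; rewrite h ?(leqW st) // /extend st.
move=> [h1 h2] s; rewrite leq_eqVlt ltnS => /orP[/eqP ->|st].
  by rewrite h2 /extend ltnn.
by rewrite h1 // /extend st.
Qed.

Let P_cyl_extend t i y :
  P (cyl t.+1 (extend t i y)) = (P (cyl t i) * (transition p (i t) y)%:E)%E.
Proof.
have [_ /(_ t (extend t i y))] := eta_mc.
have -> : extend t i y t = i t by rewrite /extend leqnn.
have -> : extend t i y t.+1 = y by rewrite /extend ltnn.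
move=> ->; congr (P _ * _)%E.
by apply/seteqP; split => x h s st; rewrite h // /extend st.
Qed.

Lemma cylinder_stay k (B : nat -> pred nat) t i :
  P (cyl t i `&` [set x | forall u, (u <= k)%N -> B u (eta (t + u)%N x)]) =
  (P (cyl t i) * (stay_prob k B (i t))%:E)%E.
Proof.
elim: k B t i => [|k IH] B t i /=.
  case Bi : (B 0%N (i t)); last first.
    rewrite mul0r mule0 (_ : _ `&` _ = set0) ?measure0 //.
    apply/seteqP; split => // x [/= h /(_ 0%N (leqnn _))].
    by rewrite addn0 h // Bi.
  rewrite mulr1 mule1; congr (P _); apply/seteqP; split => x //=; first by case.
  move=> h; split => // u; rewrite leqn0 => /eqP ->.
  by rewrite addn0 h.
case Bi : (B 0%N (i t)); last first.
  rewrite mul0r mule0 (_ : _ `&` _ = set0) ?measure0 //.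
  apply/seteqP; split => // x [/= h /(_ 0%N (leq0n _))].
  by rewrite addn0 h // Bi.
rewrite mul1r.
set E' := [set x | forall u, (u <= k)%N -> B u.+1 (eta (t.+1 + u)%N x)].
have mE' : measurable E'.
  by apply: (measurable_forall_nat (fun u j => B u.+1 j) _ (fun u => t.+1 + u)%N).
set x := i t.
have fC : P (cyl t i) \is a fin_num by apply: fin_num_measure; exact: mcyl.
set C1 := cyl t.+1 (extend t i x.-1); set C2 := cyl t.+1 (extend t i x.+1).
have mC1 : measurable C1 by exact: mcyl.
have mC2 : measurable C2 by exact: mcyl.
have C12 : [disjoint C1 & C2].
  rewrite disj_set2E; apply/eqP/seteqP; split => // w.
  rewrite /C1 /C2 !cyl_extend => -[[_ /= ->] [_ /= e]].
  by move: e; case: (x) => [|n] //= /eqP; rewrite (ltn_eqF (leqnSn _)).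
have PC12 : P (C1 `|` C2) = P (cyl t i).
  have -> : P (C1 `|` C2) = (P C1 + P C2)%E.
    by rewrite measureU //; apply/eqP; rewrite -disj_set2E.
  rewrite /C1 /C2 !P_cyl_extend transition_left transition_right.
  rewrite -muleDr ?fC //.
  by rewrite -EFinD addrC subrK mule1.
have CU : C1 `|` C2 `<=` cyl t i by rewrite /C1 /C2 !cyl_extend => w [[]|[]].
have mU : measurable (C1 `|` C2) by exact: measurableU.
have PN : P (cyl t i `\` (C1 `|` C2)) = 0%E.
  have Coo : (P (cyl t i) < +oo)%E by rewrite ltey_eq fC.
  rewrite measureD // setIidr // [X in (_ - X)%E](_ : _ = P (cyl t i)) //.
  by rewrite subee // fC.
have -> : cyl t i `&`
    [set x0 | forall u, (u <= k.+1)%N -> B u (eta (t + u)%N x0)] = cyl t i `&` E'.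
  apply/seteqP; split => w [/= h1 h2]; split => //.
    by move=> u uk; rewrite /= addSnnS; exact: h2.
  move=> [_|u uk]; first by rewrite addn0 h1.
  by move: (h2 u uk); rewrite addSnnS.
have -> : cyl t i `&` E' = (C1 `|` C2) `&` E' `|`
    (cyl t i `\` (C1 `|` C2)) `&` E'.
  by rewrite -setIUl setDUK.
have -> : P ((C1 `|` C2) `&` E' `|` (cyl t i `\` (C1 `|` C2)) `&` E') =
    (P (C1 `&` E') + P (C2 `&` E'))%E.
  rewrite measureU0 //; last 3 first.
  - exact: measurableI.
  - by apply: measurableI => //; apply: measurableD => //; exact: mcyl.
  - apply: (@subset_measure0 _ _ _ P _ (cyl t i `\` (C1 `|` C2))) => //.
    + by apply: measurableI => //; apply: measurableD => //; exact: mcyl.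
    + by apply: measurableD => //; exact: mcyl.
  rewrite setIUl measureU //; [exact: measurableI|exact: measurableI|].
  rewrite setIACA setIid.
  by have /eqP -> : C1 `&` C2 == set0; rewrite -?disj_set2E ?set0I.
rewrite /C1 /C2 !(IH (fun u => B u.+1)) !P_cyl_extend transition_left transition_right.
have ext y : extend t i y t.+1 = y by rewrite /extend ltnn.
by rewrite !ext -!muleA -muleDr ?fC // -!EFinM -EFinD.
Qed.

Lemma stay_probability k (B : nat -> pred nat) :
  P [set x | forall u, (u <= k)%N -> B u (eta u x)] = (stay_prob k B r)%:E.
Proof.
have [P0 _] := eta_mc.
have := cylinder_stay k B 0 (fun=> r).
have -> : cyl 0 (fun=> r) = [set x | eta 0%N x = r].
  by apply/seteqP; split => x /= h; [exact: h|move=> s; rewrite leqn0 => /eqP ->].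
rewrite P0 mul1e => <-.
have mB : measurable [set x | forall u, (u <= k)%N -> B u (eta u x)].
  exact: (measurable_forall_nat (fun u j => B u j) _ id).
have m0 : measurable [set x | eta 0%N x = r].
  rewrite (_ : [set x | _] = setT `&` (eta 0%N @^-1` [set r])).
    exact: measurable_funPT.
  by rewrite setTI.
have PC0 : P (~` [set x | eta 0%N x = r]) = 0%E.
  by rewrite probability_setC // P0 subee.
rewrite (measureDI P mB m0) [X in (X + _)%E](_ : _ = 0%E) ?add0e 1?setIC //.
apply: (@subset_measure0 _ _ _ P _ (~` [set x | eta 0%N x = r])) => //.
- exact: measurableD.
- exact: measurableC.
Qed.
End stay_probability.

(** * Comparison estimates for staying probabilities *)

Section stay_estimates.
Context (R : realType) (p : nat -> R).
Hypothesis p01 : forall n, 0 <= p n <= 1.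

Lemma step_le f g x : (forall y, f y <= g y) -> step p f x <= step p g x.
Proof.
move=> fg; have /andP[p0 p1] := p01 x.
by rewrite /step lerD // ler_wpM2l // subr_ge0.
Qed.

Lemma step_linear a b f x :
  step p (fun y => a + b * f y) x = a + b * step p f x.
Proof. by rewrite /step; ring. Qed.

Lemma step0 x : step p (fun=> 0) x = 0.
Proof. by rewrite /step; ring. Qed.

Lemma eq_stay_prob k (B B' : nat -> pred nat) x :
  (forall u y, B u y = B' u y) -> stay_prob p k B x = stay_prob p k B' x.
Proof.
elim: k B B' x => [|k IH] B B' x BB' /=; rewrite BB' //.
by congr (_ * _); rewrite /step !(IH (fun u => B u.+1) (fun u => B' u.+1)).
Qed.

Lemma stay_prob_ge0 k B x : 0 <= stay_prob p k B x.
Proof.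
elim: k B x => [|k IH] B x /=; rewrite mulr_ge0 ?ler0n //.
by rewrite -[leLHS](step0 x); exact: step_le.
Qed.

Lemma stay_prob_le1 k B x : stay_prob p k B x <= 1.
Proof.
elim: k B x => [|k IH] B x /=; first by rewrite mulr1; case: (B 0%N x).
have h : step p (stay_prob p k (fun u => B u.+1)) x <= 1.
  apply: (@le_trans _ _ (step p (fun=> 1) x)); first exact: step_le.
  by rewrite /step; lra.
by case: (B 0%N x); rewrite ?mul1r ?mul0r.
Qed.

(** Stopped on entering [A], [f] of the walk minus [kappa] times the elapsed time is a
    supermartingale; as [f] is at least 1 on [A], the walk enters [A] within [k] steps with
    probability at most [f x + k * kappa]. *)
Lemma stay_prob_ge_supersolution (A : pred nat) f kappa k x :
  0 <= kappa -> (forall y, 0 <= f y) -> (forall y, A y -> 1 <= f y) ->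
  (forall y, ~~ A y -> step p f y <= f y + kappa) ->
  1 - f x - k%:R * kappa <= stay_prob p k (fun=> predC A) x.
Proof.
move=> k0 f0 f1 fA; elim: k x => [|k IH] x /=.
  case Ax: (A x); rewrite /= ?mul0r ?mul1r; last by have := f0 x; lra.
  by have := f1 _ Ax; lra.
case Ax: (A x); rewrite /= ?mul0r ?mul1r.
  have := f1 _ Ax; have : 0 <= k.+1%:R * kappa by rewrite mulr_ge0.
  lra.
have := fA x; rewrite Ax => /(_ isT) fx.
apply: le_trans (step_le _ IH).
rewrite (_ : step p _ x = (1 - k%:R * kappa) + (-1) * step p f x).
  by rewrite -natr1 mulrDl mul1r; lra.
by rewrite -step_linear /step; ring.
Qed.

(** [G] dominates the mean exit time from [A], so this is Markov's inequality; the factor is [k.+1]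
    because staying through time [k] makes the exit time at least [k.+1]. *)
Lemma stay_prob_le_exit_time (A : pred nat) G k x :
  (forall y, 0 <= G y) -> (forall y, A y -> 1 + step p G y <= G y) ->
  k.+1%:R * stay_prob p k (fun=> A) x <= G x.
Proof.
move=> G0 GA.
elim: k x => [|k IH] x.
  rewrite mul1r /=; case Ax : (A x); rewrite ?mul0r ?mul1r //.
  apply: le_trans (GA _ Ax); rewrite lerDl -[leLHS](step0 x).
  exact: step_le.
have := stay_prob_le1 k.+1 (fun=> A) x; rewrite /=.
case Ax : (A x); rewrite ?mul1r ?mul0r ?mulr0 // => h1.
apply: le_trans (GA _ Ax); rewrite -natr1 mulrDl mul1r addrC lerD //.
apply: le_trans (step_le _ IH).
by rewrite /step le_eqVlt; apply/orP; left; apply/eqP; ring.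
Qed.

(** Markov property at the fixed time [s], the reason why [stay_prob] allows sets that depend on
    time. [A N] is required because the second factor tests [A] already at its time 0. *)
Lemma stay_prob_markov (A : pred nat) N s k x : A N ->
  stay_prob p (s + k)
    (fun t y => if (t < s)%N then true else if t == s then y == N else A y) x =
  stay_prob p s (fun t y => (t < s)%N || (y == N)) x *
  stay_prob p k (fun=> A) N.
Proof.
move=> AN; elim: s x => [|s IH] x.
  rewrite add0n /= mulr1; case: (eqVneq x N) => [->|xN].
    by case: k => [|k] /=; rewrite eqxx AN !mul1r.
  by case: k => [|k] /=; rewrite (negbTE xN) !mul0r.
by rewrite addSn /= !mul1r /step [RHS]mulrDl -!mulrA; congr (_ * _ + _ * _); exact: IH.
Qed.

Section potential.
(* Summing [rho] gives a function that is harmonic for the walk away from 0. *)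
Variable rho : nat -> R.
Hypothesis rho_gt0 : forall n, 0 < rho n.
Hypothesis rho_rec : forall n, p n.+1 * rho n = (1 - p n.+1) * rho n.+1.

(** The comparison function is the scale function [F]: zero up to [i], harmonic above, with a defect
    of at most [rho i] at [i] alone. At [n] and beyond it is at least [rho j], so after
    normalization each step costs [rho i / rho j]. *)
Lemma stay_below_barrier i j n k x : (x <= i)%N -> (i <= j)%N -> (j < n)%N ->
  1 - k%:R * (rho i / rho j) <= stay_prob p k (fun _ y => (y < n)%N) x.
Proof.
move=> xi ij jn.
pose F y := \sum_(i <= l < y) rho l.
have F0 y : (y <= i)%N -> F y = 0 by move=> yi; rewrite /F big_geq.
have FS y : (i <= y)%N -> F y.+1 = F y + rho y.
  by move=> iy; rewrite /F big_nat_recr.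
have Fge0 y : 0 <= F y by apply: sumr_ge0 => l _; exact: ltW.
have rj := rho_gt0 j; have ri := rho_gt0 i.
have := @stay_prob_ge_supersolution (fun y => (n <= y)%N)
  (fun y => F y / rho j) (rho i / rho j) k x.
rewrite F0 // mul0r subr0 (@eq_stay_prob _ _ (fun _ y => (y < n)%N)).
  apply.
  - by rewrite divr_ge0 ?ltW.
  - by move=> y; rewrite divr_ge0 // ltW.
  - move=> y ny; rewrite ler_pdivlMr // mul1r.
    have jy : (j < y)%N by exact: leq_trans ny.
    rewrite /F (big_cat_nat _ (n := j)) //=; last exact: ltnW.
    rewrite [X in _ + X]big_ltn //; apply: ler_wpDl; first by apply: sumr_ge0 => l _; exact: ltW.
    by rewrite lerDl; apply: sumr_ge0 => l _; exact: ltW.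
  - move=> y _.
    rewrite (_ : step p _ y = step p F y / rho j); last by rewrite /step; ring.
    rewrite -mulrDl ler_pM2r ?invr_gt0 //.
    have [yi|iy|->] := ltngtP y i.
    + rewrite /step !F0 //; last 2 first.
      * exact: ltnW.
      * by rewrite (leq_trans (leq_pred y)) // ltnW.
      by rewrite !mulr0 !add0r ltW.
    + case: y iy => // z iz; rewrite /step /= (FS z.+1 (ltnW iz)) (FS z iz).
      by have := rho_rec z; lra.
    + rewrite /step FS // !F0 ?leq_pred // mulr0 !add0r.
      by rewrite -[leRHS]mul1r ler_pM2r // gerBl; have /andP[] := p01 i.
by move=> u y; rewrite /= ltnNge.
Qed.

(** Mirror image of [stay_below_barrier]: [F] sums [rho] from [y] up to [N], with its only defect at
    [N.+1]. The extra unit in [k.+1] is the initial value [F N = rho N]. *)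
Lemma stay_above_return a N k : (a <= N)%N ->
  1 - k.+1%:R * (rho N / rho a) <= stay_prob p k (fun _ y => (a < y)%N) N.
Proof.
move=> aN.
pose F y := \sum_(y <= l < N.+1) rho l.
have F0 y : (N < y)%N -> F y = 0 by move=> yi; rewrite /F big_geq.
have FS y : (y <= N)%N -> F y = rho y + F y.+1.
  by move=> iy; rewrite /F big_ltn.
have Fge0 y : 0 <= F y by apply: sumr_ge0 => l _; exact: ltW.
have ra := rho_gt0 a; have rN := rho_gt0 N.
have := @stay_prob_ge_supersolution (fun y => (y <= a)%N)
  (fun y => F y / rho a) (rho N / rho a) k N.
rewrite FS // F0 // addr0 (@eq_stay_prob _ _ (fun _ y => (a < y)%N)).
  move=> h; apply: le_trans (h _ _ _ _).
  - by rewrite -natr1 mulrDl mul1r opprD addrA addrAC.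
  - by rewrite divr_ge0 ?ltW.
  - by move=> y; rewrite divr_ge0 // ltW.
  - move=> y ya; rewrite ler_pdivlMr // mul1r.
    rewrite /F (big_cat_nat _ (n := a)) //=; last exact: leqW.
    rewrite [X in _ + X]big_ltn //; apply: ler_wpDl; first by apply: sumr_ge0 => l _; exact: ltW.
    by rewrite lerDl; apply: sumr_ge0 => l _; exact: ltW.
  - move=> y; rewrite -ltnNge => ay.
    rewrite (_ : step p _ y = step p F y / rho a); last by rewrite /step; ring.
    rewrite -mulrDl ler_pM2r ?invr_gt0 //.
    case: y ay => // z az; rewrite /step /=.
    have [zN|Nz|zN] := ltngtP z N.
    + rewrite (FS z (ltnW zN)) (FS z.+1 zN); have := rho_rec z; lra.
    + by rewrite !F0 ?leqW // !mulr0 !add0r ltW.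
    + rewrite zN FS // !F0 // !(addr0, mulr0, add0r).
      by rewrite -[leRHS]mul1r ler_pM2r //; have /andP[] := p01 N.+1.
by move=> u y; rewrite /= ltnNge.
Qed.

(** [D m] is the mean time to go from [m] to [m.+1], the solution of the recurrence [DS] started at
    [D00], and [G] adds these up to the mean hitting time of [N]. For [m < N], [D m] has at most [N]
    terms, each at most [Q * M]. *)
Lemma stay_below_exit N Q M k x : (0 < N)%N ->
  (forall l, p l < 1) -> (forall l, (1 - p l)^-1 <= Q) ->
  (forall l m, (l <= m)%N -> (m < N)%N -> rho m / rho l <= M) ->
  k.+1%:R * stay_prob p k (fun _ y => (y < N)%N) x <= N%:R * (N%:R * (Q * M)).
Proof.
move=> N0 p1 pQ rM.
have q0 l : 0 < 1 - p l by rewrite subr_gt0.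
pose S m := \sum_(0 <= l < m.+1) ((1 - p l) * rho l)^-1.
pose D m := rho m * S m.
pose G y := \sum_(y <= m < N) D m.
have D0 m : 0 <= D m.
  apply: mulr_ge0; first exact: ltW.
  by apply: sumr_ge0 => l _; rewrite invr_ge0 mulr_ge0 // ltW.
have GS y : (y < N)%N -> G y = D y + G y.+1 by move=> yN; rewrite /G big_ltn.
have DS y : (1 - p y.+1) * D y.+1 = 1 + p y.+1 * D y.
  rewrite /D {1}/S big_nat_recr //= -/(S y) mulrDr mulrDr.
  rewrite !mulrA -rho_rec addrC rho_rec mulfV //.
  by rewrite mulf_neq0 // gt_eqF.
have D00 : (1 - p 0%N) * D 0%N = 1.
  by rewrite /D /S big_nat1 mulrA mulfV // mulf_neq0 ?gt_eqF.
have Q0 : 0 <= Q by apply: le_trans (pQ 0%N); rewrite invr_ge0 ltW.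
have M0 : 0 <= M by apply: le_trans (rM 0%N 0%N _ _) => //; rewrite divr_ge0 ?ltW.
have DM m : (m < N)%N -> D m <= N%:R * (Q * M).
  move=> mN; rewrite /D /S mulr_sumr.
  apply: (@le_trans _ _ (\sum_(0 <= l < m.+1) Q * M)).
    rewrite big_nat [leRHS]big_nat; apply: ler_sum => l /andP[_ lm].
    rewrite invfM mulrCA; apply: ler_pM => //; last exact: rM.
      by rewrite invr_ge0 ltW.
    by rewrite divr_ge0 // ltW.
  rewrite sumr_const_nat subn0 -[leLHS]mulr_natl ler_wpM2r ?mulr_ge0 //.
  by rewrite ler_nat.
apply: (@le_trans _ _ (G x)).
  apply: stay_prob_le_exit_time => [y|[|y] yN]; first exact: sumr_ge0.
    by rewrite /step /= (GS 0%N) //; move: D00; lra.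
  rewrite /step /= (GS y (ltnW yN)) (GS y.+1 yN).
  by have := DS y; lra.
apply: (@le_trans _ _ (\sum_(x <= m < N) N%:R * (Q * M))).
  rewrite /G big_nat [leRHS]big_nat; apply: ler_sum => m /andP[_ mN].
  exact: DM.
rewrite sumr_const_nat -[leLHS]mulr_natl ler_wpM2r ?mulr_ge0 //.
by rewrite ler_nat leq_subr.
Qed.

End potential.
End stay_estimates.

(** * Asymptotics and the Borel-Cantelli lemma *)

Section asymptotics.
Context (R : realType).

Lemma near_nat_ge (K : R) : \forall n \near \oo, K <= n%:R.
Proof. by near=> n; near: n; exact: nbhs_infty_ger. Unshelve. all: end_near. Qed.

Lemma near_ln_ge (K : R) : \forall n \near \oo, K <= ln n%:R.
Proof.
near=> n.
have n1 : expR K <= n%:R by near: n; exact: near_nat_ge.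
have n0 : 0 < n%:R :> R by exact: lt_le_trans (expR_gt0 K) n1.
by rewrite -(expRK K) ler_ln // posrE ?expR_gt0.
Unshelve. all: end_near. Qed.

Lemma near_powR_ge (a K : R) : 0 < a -> \forall n \near \oo, K <= n%:R `^ a.
Proof.
move=> a0; near=> n.
have nK : `|K| `^ a^-1 <= n%:R by near: n; exact: near_nat_ge.
apply: le_trans (ler_norm K) _.
have -> : `|K| = (`|K| `^ a^-1) `^ a.
  by rewrite -powRrM mulVf ?gt_eqF // powRr1.
by rewrite ge0_ler_powR ?nnegrE ?powR_ge0 // ltW.
Unshelve. all: end_near. Qed.

Lemma ln_le_powR (a x : R) : 0 < a -> 0 < x -> ln x <= a^-1 * x `^ a.
Proof.
move=> a0 x0; have := ln_sublinear (powR_gt0 a x0).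
rewrite ln_powR => /ltW; rewrite -(ler_pM2l (_ : 0 < a^-1)) ?invr_gt0 //.
by rewrite mulKf // gt_eqF.
Qed.

Lemma near_ln_le_powR (a K : R) : 0 < a ->
  \forall n \near \oo, K * ln n%:R <= n%:R `^ a.
Proof.
move=> a0; have a20 : 0 < a / 2 by rewrite divr_gt0.
near=> n.
have n1 : (1 : R) <= n%:R by near: n; exact: near_nat_ge.
have n0 : 0 < n%:R :> R by exact: lt_le_trans n1.
have : `|K| * (a / 2)^-1 <= n%:R `^ (a / 2) by near: n; exact: near_powR_ge.
move=> h; apply: (@le_trans _ _ (`|K| * ln n%:R)).
  by rewrite ler_wpM2r ?ln_ge0 // ler_norm.
apply: (@le_trans _ _ (`|K| * ((a / 2)^-1 * n%:R `^ (a / 2)))).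
  by rewrite ler_wpM2l // ln_le_powR.
have -> : n%:R `^ a = n%:R `^ (a / 2) * n%:R `^ (a / 2) :> R.
  by rewrite -powRD ?gt_eqF ?implybT // -splitr.
by rewrite mulrA ler_wpM2r ?powR_ge0.
Unshelve. all: end_near. Qed.

(** The constant is 4 times 3: [2 (n + 1) <= 4 n] and [a <= 1] bound the power by a factor 4, and
    [ln (4 n) <= 4 + ln n <= 3 ln n] once [ln n >= 2]. *)
Lemma near_powR_ln_double_le (a : R) : 0 < a -> a <= 1 -> \forall n \near \oo,
  n.+1.*2%:R `^ a * ln n.+1.*2%:R <= 12 * (n%:R `^ a * ln n%:R).
Proof.
move=> a0 a1; near=> n.
have n1 : (1 <= n)%N by near: n; exact: nbhs_infty_ge.
have l2 : 2 <= ln n%:R :> R by near: n; exact: near_ln_ge.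
have n0 : 0 < n%:R :> R by rewrite ltr0n.
have le4 : n.+1.*2%:R <= 4 * n%:R :> R by rewrite -natrM ler_nat; lia.
have p4 : n.+1.*2%:R `^ a <= 4 * n%:R `^ a :> R.
  apply: (@le_trans _ _ ((4 * n%:R) `^ a)).
    by rewrite ge0_ler_powR ?nnegrE ?mulr_ge0 // ltW.
  rewrite powRM // ler_wpM2r ?powR_ge0 //.
  by rewrite -[leRHS]powRr1 // ler_powR // ler1n.
have l4 : ln n.+1.*2%:R <= 3 * ln n%:R :> R.
  apply: (@le_trans _ _ (ln (4 * n%:R))).
    by rewrite ler_ln ?posrE ?mulr_gt0 // ltr0n double_gt0.
  rewrite lnM ?posrE //.
  have := ln_sublinear (_ : 0 < 4 :> R); rewrite ltr0n => /(_ isT).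
  by move: (ln 4) (ln _) l2 => x y; lra.
apply: (@le_trans _ _ ((4 * n%:R `^ a) * (3 * ln n%:R))).
  apply: ler_pM p4 l4; first exact: powR_ge0.
  by rewrite ln_ge0 // ler1n double_gt0.
by rewrite le_eqVlt; apply/orP; left; apply/eqP; ring.
Unshelve. all: end_near. Qed.

Lemma near_window (T : nat -> R) (a0 : nat) :
  {homo T : m n / (m <= n)%N >-> m <= n} -> (forall K, exists a, K < T a) ->
  \forall t \near \oo, exists2 a, (a0 <= a)%N & T a <= t%:R < T a.+1.
Proof.
move=> Tm Tu; near=> t.
have tT : T a0 <= t%:R by near: t; exact: near_nat_ge.
have [m tm mmin] := ex_minnP (Tu t%:R).
have a0m : (a0 < m)%N.
  by rewrite ltnNge; apply/negP => /Tm /(lt_le_trans tm); rewrite ltNge tT.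
case: m => // m in tm mmin a0m *.
exists m => //; rewrite tm andbT leNgt; apply/negP => /mmin.
by rewrite ltnn.
Unshelve. all: end_near. Qed.

(** Telescoping, from [(x + 1) ^- 2 <= x^-1 - (x + 1)^-1]; the convention [0^-1 = 0] covers the
    empty sum. *)
Lemma sum_inv_sqr_le n : \sum_(0 <= k < n) (k.+1%:R ^- 2 : R) <= 2 - n%:R^-1.
Proof.
elim: n => [|[|n] IH]; first by rewrite big_geq // invr0 subr0.
  by rewrite big_nat1 expr1n invr1; lra.
rewrite big_nat_recr //=; apply: le_trans (lerD IH (lexx _)) _.
set x : R := n.+1%:R; have x0 : 0 < x by rewrite ltr0n.
have -> : n.+2%:R = x + 1 :> R by rewrite /x natr1.
have : (x + 1) ^- 2 <= x^-1 - (x + 1)^-1.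
  have -> : x^-1 - (x + 1)^-1 = (x * (x + 1))^-1.
    by field; apply/andP; split; lra.
  have x1 : 0 < x + 1 by lra.
  by rewrite lef_pV2 ?posrE ?mulr_gt0 ?exprn_gt0 //; nra.
by move: ((x + 1) ^- 2) x^-1 (x + 1)^-1 => u v w; lra.
Qed.

Lemma borel_cantelli d (T : measurableType d) (P : probability T R)
    (A : nat -> set T) :
  (forall n, measurable (A n)) ->
  (\forall n \near \oo, (P (A n) <= (expR (- (2 * ln n%:R)))%:E)%E) ->
  {ae P, forall x, \forall n \near \oo, ~ A n x}.
Proof.
move=> mA [n0 _ hn0].
(* The shift by [n0.+1] starts the series where the bound holds and keeps the index positive, so
   that [exp (- 2 ln n)] is the summable [n ^- 2]. *)
pose F n := A (n + n0.+1)%N.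
have PF n : (P (F n) <= (n.+1%:R ^- 2)%:E)%E.
  apply: le_trans (hn0 (n + n0.+1)%N _) _.
    by rewrite /= addnS -addSn leq_addl.
  have m0 : 0 < (n + n0.+1)%:R :> R by rewrite ltr0n addnS.
  rewrite lee_fin expRN mulrDl mul1r expRD lnK ?posrE //.
  rewrite lef_pV2 ?posrE ?mulr_gt0 ?exprn_gt0 //.
  rewrite expr2 ler_pM //.
    by rewrite ler_nat addnS ltnS leq_addr.
  by rewrite ler_nat addnS ltnS leq_addr.
exists (lim_sup_set F); split.
- by apply: bigcap_measurable => [|k _]; [exists 0%N|
    by apply: bigcup_measurable => j _; exact: mA].
- apply: lim_sup_set_cvg0 => [k|]; first exact: mA.
  apply: (@le_lt_trans _ _ 2%:E); last exact: ltry.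
  apply: lime_le; first exact: is_cvg_nneseries.
  apply: nearW => n.
  apply: (@le_trans _ _ (\sum_(0 <= k < n) (k.+1%:R ^- 2)%:E)%E).
    by apply: lee_sum => k _; exact: PF.
  rewrite sumEFin lee_fin; apply: le_trans (sum_inv_sqr_le n) _.
  by rewrite gerBl.
- move=> x /= hx n _; apply: contrapT => hn; apply: hx.
  exists (n + n0.+1)%N => //= m nm hm; apply: hn.
  exists (m - n0.+1)%N => /=.
    by rewrite leq_subRL ?(leq_trans _ nm) ?leq_addl // addnC.
  by rewrite /F subnK // (leq_trans _ nm) // leq_addl.
Qed.

End asymptotics.

(** * Speed of the walk from the shape of the potential *)

(** A nearest-neighbour walk started below [N] cannot pass [N] without visiting it. *)
Lemma stay_off_eq_stay_below (R : realType) (p : nat -> R) N k x : (x < N)%N ->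
  stay_prob p k (fun _ y => y != N) x = stay_prob p k (fun _ y => (y < N)%N) x.
Proof.
elim: k x => [|k IH] x xN /=; rewrite xN (ltn_eqF xN) //.
congr (_ * _); rewrite /step (IH x.-1) ?(leq_ltn_trans (leq_pred x)) //.
have [xN1|] := ltnP x.+1 N; first by rewrite IH.
move=> Nx; have -> : x.+1 = N by apply/eqP; rewrite eqn_leq xN Nx.
by case: (k) => [|k'] /=; rewrite eqxx ltnn !mul0r.
Qed.

Section speed.
Context (R : realType) (p V : nat -> R) (Q alpha C c2 : R).
Hypothesis p01 : forall n, 0 <= p n <= 1.
Hypothesis p_lt1 : forall n, p n < 1.
Hypothesis p_le : forall n, (1 - p n)^-1 <= Q.
Hypothesis V_rec : forall n,
  p n.+1 * expR (V n) = (1 - p n.+1) * expR (V n.+1).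
Hypothesis alpha0 : 0 < alpha.
Hypothesis alpha12 : alpha < 2^-1.
Hypothesis C0 : 0 < C.
Hypothesis c20 : 0 < c2.
Hypothesis V_drawup_le : \forall N \near \oo, forall i j,
  (i <= j)%N -> (j < N)%N -> V j - V i <= C * (N%:R `^ alpha * ln N%:R).
Hypothesis V_drift : \forall a \near \oo,
  V a.*2 - V a <= - (c2 * a%:R `^ (1 - alpha)).

Context d (T : measurableType d) (P : probability T R) (r : nat)
  (eta : nat -> {RV P >-> nat}).
Hypothesis eta_mc : markov_chain (transition p) r eta.

Let M (N : nat) : R := C * (N%:R `^ alpha * ln N%:R).
(** The mean hitting time of [N] is at most [N^2 Q exp (M N)]. Doubling the exponent leaves a factor
    [exp (- M N)] in Markov's inequality, small enough to absorb [N^2 Q] and still be summable. *)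
Let time (N : nat) : nat := Num.truncn (expR (2 * M N)).

Let truncnP (x : R) : 0 <= x ->
  (Num.truncn x)%:R <= x /\ x < (Num.truncn x).+1%:R.
Proof. by move=> /Num.Theory.truncn_itv /andP[]. Qed.

Let Q0 : 0 < Q.
Proof. by apply: lt_le_trans (p_le 0%N); rewrite invr_gt0 subr_gt0. Qed.

Let alpha_le1 : alpha <= 1.
Proof. by have := alpha12; lra. Qed.

Let alpha_compl_gt0 : 0 < 1 - 2 * alpha.
Proof. by have := alpha12; lra. Qed.

Let two_div_alpha_ge1 : 1 <= 2 / alpha.
Proof. by rewrite ler_pdivlMr // mul1r; have := alpha12; lra. Qed.

Let exp_ratio m n : expR (V m) / expR (V n) = expR (V m - V n).
Proof. by rewrite expRB. Qed.

Let measurable_stay (B : nat -> pred nat) k :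
  measurable [set x | forall u, (u <= k)%N -> B u (eta u x)].
Proof. exact: (measurable_forall_nat eta (fun u j => B u j) _ id). Qed.

Let M_ge0 N : 0 <= M N.
Proof.
rewrite mulr_ge0 ?(ltW C0) // mulr_ge0 ?powR_ge0 //.
by case: N => [|N]; [rewrite ln0|rewrite ln_ge0 // ler1n].
Qed.

Let M_double_le : \forall a \near \oo,
  M a.+1.*2 <= 12 * C * (a%:R `^ alpha * ln a%:R).
Proof.
apply: filterS (near_powR_ln_double_le alpha0 alpha_le1) => a h.
by rewrite /M -mulrA (mulrC 12) -mulrA ler_pM2l // mulrC.
Qed.

Lemma hitting_time_ub : {ae P, forall x, \forall N \near \oo,
  exists2 s, (s <= time N)%N & eta s x = N}.
Proof.
have := @borel_cantelli R _ _ P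
  (fun N => [set x | forall u, (u <= time N)%N -> eta u x != N]).
move=> H; apply: filterS (H _ _) => [x|N|].
- apply: filterS => N hN; apply: contrapT => hn; apply: hN => u uN.
  by apply/eqP => e; apply: hn; exists u.
- exact: (measurable_stay (fun _ y => y != N)).
- near=> N.
  rewrite (stay_probability eta_mc _ (fun _ y => y != N)) lee_fin.
  have rN : (r < N)%N by near: N; exact: nbhs_infty_gt.
  have N0 : (0 < N)%N by exact: leq_ltn_trans rN.
  rewrite stay_off_eq_stay_below //.
  have hV : forall i j, (i <= j)%N -> (j < N)%N -> V j - V i <= M N.
    by near: N; exact: V_drawup_le.
  have hM l m : (l <= m)%N -> (m < N)%N ->
      expR (V m) / expR (V l) <= expR (M N).
    by move=> lm mN; rewrite exp_ratio ler_expR; exact: hV.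
  have := stay_below_exit p01 (fun n => expR_gt0 (V n)) V_rec (time N) r N0
    p_lt1 p_le hM.
  set S := stay_prob _ _ _ _ => hS.
  have S0 : 0 <= S by exact: stay_prob_ge0.
  have [_ tN] := truncnP (expR_ge0 (2 * M N)).
  have {}hS : expR (2 * M N) * S <= N%:R * (N%:R * (Q * expR (M N))).
    by apply: le_trans hS; rewrite ler_wpM2r // ltW.
  have lnN1 : 1 <= ln N%:R :> R by near: N; exact: near_ln_ge.
  have hN : (4 + Q) / C <= N%:R `^ alpha by near: N; exact: near_powR_ge.
  have hN' : 4 + Q <= C * N%:R `^ alpha.
    by rewrite mulrC -ler_pdivrMr.
  have MN : 4 * ln N%:R + Q <= M N.
    rewrite /M mulrA; have := Q0.
    by move: (C * _) hN' (ln _) lnN1 => A hA l hl Qp; nra.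
  have N0' : 0 < N%:R :> R by rewrite ltr0n.
  rewrite -(ler_pM2l (expR_gt0 (2 * M N))); apply: le_trans hS _.
  rewrite -(lnK (_ : N%:R \is Num.pos)) ?posrE // expRK.
  apply: (@le_trans _ _ (expR (ln N%:R) * (expR (ln N%:R) *
    (expR Q * expR (M N))))).
    rewrite !ler_pM2l ?expR_gt0 // ler_pM2r ?expR_gt0 //.
    by have := expR_ge1Dx Q; lra.
  rewrite -!expRD ler_expR.
  by move: (ln N%:R) (M N) MN => l m; lra.
Unshelve. all: end_near. Qed.

(** The visit time [s] is random, hence a union over all [s <= U a]. Each term costs at most
    [(U a).+1 * exp (V (2a) - V a)], so the square of a time of order [exp (2 M (2a + 2))] competes
    with [exp (- c2 a^(1 - alpha))]. *)
Lemma no_return : {ae P, forall x, \forall a \near \oo,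
  forall s u, (s <= time a.+1.*2)%N -> (u <= time a.+1.*2)%N ->
  eta s x = a.*2 -> (a < eta (s + u)%N x)%N}.
Proof.
pose U a := time a.+1.*2.
pose E1 a s := [set x | forall t, (t <= s)%N -> (t < s)%N || (eta t x == a.*2)].
(* The part of [E1 a s] on which the walk stays above [a] for [U a] more steps, in the form that
   [stay_prob_markov] factorizes. *)
pose E2 a s := [set x | forall t, (t <= s + U a)%N ->
  if (t < s)%N then true else
  if t == s then eta t x == a.*2 else (a < eta t x)%N].
have mE1 a s : measurable (E1 a s).
  exact: (measurable_stay (fun t y => (t < s)%N || (y == a.*2))).
have mE2 a s : measurable (E2 a s).
  exact: (measurable_stay (fun t y => if (t < s)%N then true else
    if t == s then y == a.*2 else (a < y)%N)).
have mE a s : measurable (E1 a s `\` E2 a s) by exact: measurableD.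
have := @borel_cantelli R _ _ P
  (fun a => \big[setU/set0]_(s < (U a).+1) (E1 a s `\` E2 a s)).
move=> H; apply: filterS (H _ _) => [x|a|].
- move=> hx; apply: filterS2 (nbhs_infty_gt 0) hx => a a0 hN s u sU uU esa.
  rewrite ltnNge; apply/negP => eu; apply: hN.
  rewrite -(bigcup_mkord _ (fun s => E1 a s `\` E2 a s)); exists s => //=; split.
    move=> t; rewrite leq_eqVlt => /orP[/eqP ->|-> //].
    by rewrite esa eqxx orbT.
  move=> /(_ (s + u)%N); rewrite leq_add2l => /(_ uU).
  rewrite ltnNge leq_addr /=; case: eqP => [e|_].
    by move: eu; rewrite e esa -addnn => eu; move: a0 eu; rewrite /=; lia.
  by rewrite ltnNge eu.
- exact: bigsetU_measurable.
- near=> a.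
  have a0 : (0 < a)%N by near: a; exact: nbhs_infty_gt.
  have a2 : (a < a.*2)%N by rewrite -addnn -{1}[a]addn0 ltn_add2l.
  set S := stay_prob p (U a) (fun _ y => (a < y)%N) a.*2.
  have PE s : (P (E1 a s `\` E2 a s) <= (1 - S)%:E)%E.
    have sub : E2 a s `<=` E1 a s.
      move=> x h t ts; have := h t (leq_trans ts (leq_addr _ _)).
      move: ts; rewrite leq_eqVlt => /orP[/eqP ->|-> //].
      by rewrite ltnn eqxx.
    have e1 := stay_probability eta_mc s (fun t y => (t < s)%N || (y == a.*2)).
    have e2 := stay_probability eta_mc (s + U a) (fun t y =>
      if (t < s)%N then true else if t == s then y == a.*2 else (a < y)%N).
    rewrite (@stay_prob_markov _ p (fun y => (a < y)%N) a.*2 s (U a) r a2) in e2.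
    rewrite measureD //; last by rewrite -/(E1 a s) ltey_eq fin_num_measure.
    rewrite setIidr //.
    rewrite [X in (X - _)%E]e1 [X in (_ - X)%E]e2 -EFinB lee_fin.
    have s0 := stay_prob_ge0 p01 s (fun t y => (t < s)%N || (y == a.*2)) r.
    have s1 : stay_prob p s (fun t y => (t < s)%N || (y == a.*2)) r <= 1.
      exact: stay_prob_le1.
    have S1 : S <= 1 by exact: stay_prob_le1.
    by rewrite -/S; nra.
  have UT : (U a).+1%:R <= expR (2 + 2 * M a.+1.*2).
    have [tU _] := truncnP (expR_ge0 (2 * M a.+1.*2)).
    have T1 : 1 <= expR (2 * M a.+1.*2).
      by rewrite -expR0 ler_expR mulr_ge0 // M_ge0.
    have e2 := expR_ge1Dx (2 : R).
    rewrite expRD -natr1; move: tU T1 e2; rewrite -/(time _) -/(U a).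
    by move: (expR _) (expR _) => x y *; nra.
  have PU : (P (\big[setU/set0]_(s < (U a).+1) (E1 a s `\` E2 a s)) <=
      ((U a).+1%:R * (1 - S))%:E)%E.
    apply: le_trans (@Boole_inequality _ _ _ P (fun s => E1 a s `\` E2 a s)
      (U a).+1 (fun s _ => mE a s)) _.
    apply: (@le_trans _ _ (\sum_(s < (U a).+1) (1 - S)%:E)%E).
      by apply: lee_sum => s _; exact: PE.
    by rewrite sumEFin sumr_const card_ord mulr_natl.
  apply: le_trans PU _; rewrite lee_fin.
  have := stay_above_return p01 (fun n => expR_gt0 (V n)) V_rec (U a) (ltnW a2).
  rewrite exp_ratio -/S => hS.
  have {}hS : 1 - S <= (U a).+1%:R * expR (V a.*2 - V a).
    by move: hS; move: (_ * _) => z; lra.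
  have hV : V a.*2 - V a <= - (c2 * a%:R `^ (1 - alpha)).
    by near: a; exact: V_drift.
  apply: (@le_trans _ _ (expR (2 + 2 * M a.+1.*2) * (expR (2 + 2 * M a.+1.*2) *
    expR (- (c2 * a%:R `^ (1 - alpha)))))).
    apply: ler_pM => //.
      by rewrite subr_ge0; exact: stay_prob_le1.
    apply: le_trans hS _; apply: ler_pM => //; by rewrite ler_expR.
  rewrite -!expRD ler_expR.
  have hM : M a.+1.*2 <= 12 * C * (a%:R `^ alpha * ln a%:R).
    by near: a; exact: M_double_le.
  have a1 : 1 <= ln a%:R :> R by near: a; exact: near_ln_ge.
  have aa1 : 1 <= a%:R `^ alpha :> R by near: a; exact: near_powR_ge.
  have h12 := alpha_compl_gt0.
  (* 48 comes from [4 * M] with the bound [12 * C] on [M a.+1.*2]; 6 absorbs [4 + 2 * ln a], the 2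
     being the one of Borel-Cantelli. *)
  have : ((48 * C + 6) / c2) * ln a%:R <= a%:R `^ (1 - 2 * alpha) :> R.
    by near: a; exact: near_ln_le_powR.
  rewrite mulrAC ler_pdivrMr // => hK.
  have -> : a%:R `^ (1 - alpha) = a%:R `^ alpha * a%:R `^ (1 - 2 * alpha) :> R.
    rewrite -powRD; first by congr (_ `^ _); lra.
    by rewrite pnatr_eq0 -lt0n a0 implybT.
  move: (a%:R `^ alpha) (a%:R `^ (1 - 2 * alpha)) (ln a%:R) hK hM aa1 a1.
  move: (M _) => m A B l hK hM A1 l1.
  have h1 : A * ((48 * C + 6) * l) <= A * (B * c2) by rewrite ler_pM2l //; lra.
  have h2 : l <= A * l by rewrite ler_peMl //; lra.
  by nra.
Unshelve. all: end_near. Qed.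

(** For [t] between [W a] and [W a.+1] the site [2a] has been visited and the walk has not come back
    to [a] since, so [eta t > a], while [ln t] is at most of order [a^alpha ln a]. The factor
    [ln a], at most a multiple of [ln (ln t)], costs the power [1 / alpha]; [eps] absorbs the
    constants. *)
Lemma speed_lower (eps : R) : 0 < eps -> {ae P, forall x, \forall t \near \oo,
  (ln (ln t%:R)) `^ (- (1 / alpha) - eps) < (eta t x)%:R / (ln t%:R) `^ (1 / alpha)}.
Proof.
move=> eps0; apply: filterS2 hitting_time_ub no_return => x h1 h2.
pose W a := expR (2 * M a.*2).
have Mmono m n : (m <= n)%N -> M m <= M n.
  move=> mn; rewrite ler_pM2l //.
  case: m mn => [|m] mn; first by rewrite ln0 // mulr0 -(ler_pM2l C0) mulr0; exact: M_ge0.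
  have n0 : (0 < n)%N by exact: leq_trans mn.
  apply: ler_pM; first exact: powR_ge0.
  - by rewrite ln_ge0 // ler1n.
  - by rewrite ge0_ler_powR ?nnegrE ?ler_nat // ltW.
  - by rewrite ler_ln ?posrE ?ltr0n // ler_nat.
have Wm : {homo W : m n / (m <= n)%N >-> m <= n}.
  by move=> m n mn; rewrite ler_expR ler_pM2l // Mmono // leq_double.
have near2 (S : set nat) : (\forall n \near \oo, S n) ->
    \forall a \near \oo, S a.*2.
  by move=> [n0 _ h]; exists n0 => // a /= na; apply: h; rewrite /= -addnn (leq_trans na) // leq_addl.
have M_ge (K : R) : \forall N \near \oo, K <= M N.
  near=> N.
  have l1 : 1 <= ln N%:R :> R by near: N; exact: near_ln_ge.
  have : `|K| / C <= N%:R `^ alpha by near: N; exact: near_powR_ge.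
  rewrite ler_pdivrMr // => h; apply: le_trans (ler_norm K) _.
  apply: le_trans h _; rewrite /M mulrC ler_pM2l // ler_peMr //.
have Wu K : exists a, K < W a.
  have /near2 [a _ /(_ a (leqnn a)) /= ha] := M_ge `|K|.
  exists a; apply: le_lt_trans (ler_norm K) _; apply: le_lt_trans ha _.
  have := expR_ge1Dx (2 * M a.*2); have := M_ge0 a.*2.
  by rewrite /W; move: (M _) => m; lra.
(* Dividing by [alpha] writes [24 * C * ln a] as a constant times [alpha * ln a], which is the lower
   bound available for [ln (ln t)]. *)
pose K := 4 * (24 * C / alpha) `^ (1 / alpha).
have [a0 _ ha0] : \forall a \near \oo, [/\ (exists2 s, (s <= time a.*2)%N & eta s x = a.*2),
   (forall s u, (s <= time a.+1.*2)%N -> (u <= time a.+1.*2)%N ->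
     eta s x = a.*2 -> (a < eta (s + u)%N x)%N),
   M a.+1.*2 <= 12 * C * (a%:R `^ alpha * ln a%:R) &
   [/\ 1 <= ln a%:R :> R, 1 <= 2 * C * ln a.*2%:R, 1 <= M a.*2 &
     (K + 1) `^ eps^-1 / alpha <= ln a%:R] ].
  near=> a; split; [| | |split].
  - by near: a; exact: (near2 [set N | exists2 s, (s <= time N)%N & eta s x = N]).
  - by near: a.
  - by near: a; exact: M_double_le.
  - by near: a; exact: near_ln_ge.
  - rewrite -ler_pdivrMl ?mulr_gt0 // mulr1.
    by near: a; apply: (near2 [set N | _ <= ln N%:R]); exact: near_ln_ge.
  - by near: a; apply: (near2 [set N | 1 <= M N]); exact: M_ge.
  - by near: a; exact: near_ln_ge.
near=> t.
have [a a0a /andP[Wt tW]] : exists2 a, (a0 <= a)%N & W a <= t%:R < W a.+1.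
  by near: t; exact: near_window.
have [[s sa es] ret hM [l1 l2 M1 lK]] := ha0 a a0a.
have t0 : 0 < t%:R :> R by apply: lt_le_trans Wt; exact: expR_gt0.
have aeta : (a < eta t x)%N.
  have st : (s <= t)%N.
    rewrite -(ler_nat R); apply: le_trans Wt.
    have [tU _] := truncnP (expR_ge0 (2 * M a.*2)).
    by apply: le_trans tU; rewrite ler_nat.
  have tU : (t <= time a.+1.*2)%N.
    rewrite -ltnS -(ltr_nat R); apply: lt_trans tW _.
    by have [_] := truncnP (expR_ge0 (2 * M a.+1.*2)).
  rewrite -(subnKC st); apply: ret => //; first exact: leq_trans tU.
  exact: leq_trans (leq_subr _ _) tU.
have a1 : 0 < a%:R :> R.
  by rewrite ltr0n lt0n; apply/eqP => a0'; move: l1; rewrite a0' ln0 //; lra.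
have lnt1 : 2 * M a.*2 <= ln t%:R.
  by rewrite -(expRK (2 * M a.*2)) ler_ln ?posrE ?expR_gt0.
have lnt2 : ln t%:R <= 2 * M a.+1.*2.
  by rewrite -(expRK (2 * M a.+1.*2)) ler_ln ?posrE ?expR_gt0 // ltW.
have lnt0 : 0 < ln t%:R :> R by apply: lt_le_trans lnt1; lra.
have alpha1 : 0 < 1 / alpha by rewrite div1r invr_gt0.
rewrite ltr_pdivlMr ?powR_gt0 //.
apply: (@lt_trans _ _ a%:R); last by rewrite ltr_nat.
have lnln : alpha * ln a%:R <= ln (ln t%:R).
  rewrite -ln_powR ler_ln ?posrE ?powR_gt0 //; apply: le_trans lnt1.
  apply: (@le_trans _ _ (a.*2%:R `^ alpha)).
    rewrite ge0_ler_powR ?nnegrE ?(ltW alpha0) // ler_nat -addnn; exact: leq_addl.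
  rewrite /M [leRHS](_ : _ = a.*2%:R `^ alpha * (2 * C * ln a.*2%:R)); last by ring.
  by rewrite ler_peMr // powR_ge0.
have al0 : 0 < alpha * ln a%:R by rewrite mulr_gt0 //; lra.
have lnt3 : (ln t%:R) `^ (1 / alpha) <=
    a%:R * ((24 * C / alpha) `^ (1 / alpha) * (alpha * ln a%:R) `^ (1 / alpha)).
  apply: (@le_trans _ _ ((a%:R `^ alpha * (24 * C / alpha * (alpha * ln a%:R))) `^ (1 / alpha))).
    rewrite ge0_ler_powR ?nnegrE ?(ltW alpha1) ?(ltW lnt0) //.
      by rewrite !mulr_ge0 ?powR_ge0 ?invr_ge0 ?(ltW C0) ?(ltW alpha0) // ln_ge0 // ler1n -(ltr0n R).
    apply: le_trans lnt2 _; rewrite [leRHS](_ : _ = 2 * (12 * C * (a%:R `^ alpha * ln a%:R))).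
      by rewrite ler_pM2l.
    by field; rewrite gt_eqF.
  have g0 : 0 <= 24 * C / alpha by rewrite !mulr_ge0 ?invr_ge0 ?(ltW C0) ?(ltW alpha0).
  rewrite (powRM _ (powR_ge0 _ _) (mulr_ge0 g0 (ltW al0))).
  rewrite (powRM _ g0 (ltW al0)).
  have -> : (a%:R `^ alpha) `^ (1 / alpha) = a%:R :> R.
    by rewrite -powRrM div1r mulfV ?gt_eqF // powRr1 // ltW.
  exact: lexx.
(* The exponent is negative, so the lower bound on [ln (ln t)] is reversed. *)
have lnln' : (ln (ln t%:R)) `^ (- (1 / alpha) - eps) <= (alpha * ln a%:R) `^ (- (1 / alpha) - eps).
  rewrite -opprD !powRN lef_pV2 ?posrE ?powR_gt0 //; last first.
    exact: lt_le_trans lnln.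
  rewrite ge0_ler_powR ?nnegrE ?addr_ge0 ?(ltW alpha1) ?(ltW eps0) ?(ltW al0) //.
  by apply: le_trans lnln; exact: ltW.
apply: le_lt_trans (ler_pM _ _ lnln' lnt3) _; rewrite ?powR_ge0 //.
set z := alpha * ln a%:R in al0 lnln lnt3 lnln' *.
have zK : K + 1 <= z `^ eps.
  have K0 : 0 <= K + 1 by rewrite addr_ge0 // mulr_ge0 // powR_ge0.
  have -> : K + 1 = ((K + 1) `^ eps^-1) `^ eps.
    by rewrite -powRrM mulVf ?gt_eqF // powRr1.
  rewrite ge0_ler_powR ?nnegrE ?(ltW eps0) ?powR_ge0 ?(ltW al0) //.
  by rewrite /z mulrC -ler_pdivrMr.
rewrite powRB; last by rewrite (gt_eqF al0) implybT.
rewrite powRN.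
have zz : 0 < z `^ (1 / alpha) by rewrite powR_gt0.
have ze : 0 < z `^ eps by rewrite powR_gt0.
rewrite [ltLHS](_ : _ = a%:R * ((24 * C / alpha) `^ (1 / alpha) / z `^ eps)).
  rewrite gtr_pMr // ltr_pdivrMr // (mul1r (z `^ eps)); apply: lt_le_trans zK.
  have := powR_ge0 (24 * C / alpha) (1 / alpha).
  by rewrite /K; move: (_ `^ _) => y; lra.
by field; rewrite !gt_eqF.
Unshelve. all: end_near. Qed.

Variable c3 : R.
Hypothesis c30 : 0 < c3.
Hypothesis V_drawup_ge : \forall n \near \oo, exists i j,
  [/\ (n./2 <= i)%N, (i <= j)%N, (j < n)%N & c3 * n%:R `^ alpha <= V j - V i].

(** The foot [i] of the barrier is at least [n./2], hence eventually not below the start [r]. Half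
    of the height [c3 n^alpha] pays for the time horizon, the other half makes the crossing
    probability summable. *)
Lemma hitting_time_lb : {ae P, forall x, \forall n \near \oo,
  forall u, (u <= Num.truncn (expR (c3 / 2 * n%:R `^ alpha)))%N ->
  (eta u x < n)%N}.
Proof.
pose K n := Num.truncn (expR (c3 / 2 * n%:R `^ alpha)).
have mE n : measurable [set x | forall u, (u <= K n)%N -> (eta u x < n)%N].
  exact: (measurable_stay (fun _ y => (y < n)%N)).
have := @borel_cantelli R _ _ P
  (fun n => ~` [set x | forall u, (u <= K n)%N -> (eta u x < n)%N]).
move=> H; apply: filterS (H _ _) => [x|n|].
- by apply: filterS => n /contrapT.
- exact: measurableC.
- near=> n.
  rewrite probability_setC //.
  rewrite [X in (_ - X)%E](stay_probability eta_mc _ (fun _ y => (y < n)%N)).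
  rewrite -EFinB lee_fin.
  have [i [j [ni ij jn hij]]] : exists i j,
    [/\ (n./2 <= i)%N, (i <= j)%N, (j < n)%N & c3 * n%:R `^ alpha <= V j - V i].
    by near: n; exact: V_drawup_ge.
  have rn : (r.*2 <= n)%N by near: n; exact: nbhs_infty_ge.
  have ri : (r <= i)%N.
    by apply: leq_trans ni; rewrite -(doubleK r) half_leq.
  have := stay_below_barrier p01 (fun n => expR_gt0 (V n)) V_rec (K n) ri ij jn.
  rewrite exp_ratio lerBlDr => h.
  rewrite lerBlDr; apply: le_trans h _; rewrite addrC lerD2r.
  have [tn _] := truncnP (expR_ge0 (c3 / 2 * n%:R `^ alpha)).
  apply: (@le_trans _ _ (expR (c3 / 2 * n%:R `^ alpha) * expR (V i - V j))).
    by rewrite ler_wpM2r ?expR_ge0.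
  rewrite -expRD ler_expR.
  have : (4 / c3) * ln n%:R <= n%:R `^ alpha by near: n; exact: near_ln_le_powR.
  rewrite mulrAC ler_pdivrMr // => h4.
  by move: (n%:R `^ alpha) (ln n%:R) h4 hij => A L h4 hij; lra.
Unshelve. all: end_near. Qed.

(** [y] solves [exp (c3 / 2 * y^alpha) = t] and [n] is the next integer, so [eta t < n] bounds the
    ratio by the constant [K], which [ln (ln t)] eventually exceeds. *)
Lemma speed_upper (eps : R) : 0 < eps -> {ae P, forall x, \forall t \near \oo,
  (eta t x)%:R / (ln t%:R) `^ (1 / alpha) < (ln (ln t%:R)) `^ (2 / alpha + eps)}.
Proof.
move=> eps0; apply: filterS hitting_time_lb => x [n0 _ h].
have alpha1 : 0 < 1 / alpha by rewrite div1r invr_gt0.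
pose K := (2 / c3) `^ (1 / alpha) + 1.
near=> t.
pose y := (2 / c3 * ln t%:R) `^ (1 / alpha).
pose n := (Num.truncn y).+1.
have lt1 : 1 <= ln t%:R :> R by near: t; exact: near_ln_ge.
have ltn0 : c3 / 2 * n0%:R `^ alpha <= ln t%:R by near: t; exact: near_ln_ge.
have llt : expR (K + 1) <= ln t%:R by near: t; exact: near_ln_ge.
have t1 : 0 < t%:R :> R.
  by rewrite ltr0n lt0n; apply/eqP => t0; move: lt1; rewrite t0 ln0 //; lra.
have [yn1 yn2] := truncnP (powR_ge0 (2 / c3 * ln t%:R) (1 / alpha)).
rewrite -/y -/n in yn1 yn2.
have g0 : 0 <= 2 / c3 * ln t%:R.
  by rewrite mulr_ge0 ?divr_ge0 ?(ltW c30) //; lra.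
have yal : y `^ alpha = 2 / c3 * ln t%:R.
  by rewrite /y -powRrM div1r mulVf ?gt_eqF // powRr1.
have n0n : (n0 <= n)%N.
  rewrite ltnW // -(ltr_nat R); apply: le_lt_trans yn2.
  have e : n0%:R = (n0%:R `^ alpha) `^ (1 / alpha) :> R.
    by rewrite -powRrM div1r mulfV ?gt_eqF // powRr1.
  rewrite e ge0_ler_powR ?nnegrE ?powR_ge0 ?(ltW alpha1) //.
  move: ltn0; rewrite -ler_pdivlMl ?divr_gt0 // => /le_trans; apply.
  by rewrite invf_div.
have := h n n0n t; rewrite /=.
have -> : (t <= Num.truncn (expR (c3 / 2 * n%:R `^ alpha)))%N.
  rewrite -ltnS -(ltr_nat R).
  have [_] := truncnP (expR_ge0 (c3 / 2 * n%:R `^ alpha)).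
  apply: le_lt_trans; rewrite -[leLHS](@lnK _ t%:R) ?posrE // ler_expR.
  rewrite -ler_pdivrMl ?divr_gt0 // invf_div -yal.
  by rewrite ge0_ler_powR ?nnegrE ?(ltW alpha0) ?powR_ge0 // ltW.
move=> /(_ isT) etan.
have L0 : 0 < (ln t%:R) `^ (1 / alpha) :> R by rewrite powR_gt0; lra.
have L1 : 1 <= (ln t%:R) `^ (1 / alpha) :> R.
  apply: (@le_trans _ _ (1 `^ (1 / alpha))); first by rewrite powR1.
  by rewrite ge0_ler_powR ?nnegrE ?(ltW alpha1) //; lra.
have llt1 : K + 1 <= ln (ln t%:R).
  by rewrite -(expRK (K + 1)) ler_ln ?posrE ?expR_gt0 //; lra.
have K0 : 0 <= K by rewrite addr_ge0 ?powR_ge0.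
apply: (@le_lt_trans _ _ K).
  rewrite ler_pdivrMr //; apply: (@le_trans _ _ (y + 1)).
    apply: (@le_trans _ _ (Num.truncn y)%:R); first by rewrite ler_nat -ltnS.
    by apply: le_trans yn1 _; rewrite lerDl.
  rewrite /y powRM ?divr_ge0 ?(ltW c30) //; last by lra.
  by rewrite [leRHS]mulrDl lerD2l ler_peMr.
apply: (@lt_le_trans _ _ (K + 1)); first by rewrite ltrDl.
have ll0 : 1 <= ln (ln t%:R) :> R by apply: (le_trans _ llt1); rewrite lerDr.
apply: le_trans llt1 _.
rewrite -[leLHS]powRr1 ?ler_powR //; last by lra.
by apply: le_trans two_div_alpha_ge1 _; rewrite lerDl ltW.
Unshelve. all: end_near. Qed.

End speed.

(** * Expectations and independence *)

Section bounded_expectation.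
Context d (T : measurableType d) (R : realType) (P : probability T R).
Implicit Types f g : T -> R.

(** Bounded everywhere, not only almost everywhere: the variables used below are clipped, so
    integrability is automatic and stable under sums, products and exponentials. *)
Definition bounded_rv f :=
  measurable_fun [set: T] f /\ exists M, forall x, `|f x| <= M.

Definition expect f : R := \int[P]_x f x.

Lemma bounded_rv_integrable f : bounded_rv f -> P.-integrable [set: T] (EFin \o f).
Proof.
move=> [mf [M fM]]; apply: measurable_bounded_integrable => //.
  by rewrite (le_lt_trans (probability_le1 _ _)) // ltry.
exists M; split; first exact: num_real.
by move=> y My x _; apply: le_trans (fM x) _; exact: ltW.
Qed.

Lemma bounded_rv_cst c : bounded_rv (fun=> c).
Proof. by split; [exact: measurable_cst|exists `|c|]. Qed.

Lemma bounded_rvD f g : bounded_rv f -> bounded_rv g ->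
  bounded_rv (fun x => f x + g x).
Proof.
move=> [mf [M fM]] [mg [N gN]]; split; first exact: measurable_funD.
by exists (M + N) => x; apply: le_trans (ler_normD _ _) _; exact: lerD.
Qed.

Lemma bounded_rvM f g : bounded_rv f -> bounded_rv g ->
  bounded_rv (fun x => f x * g x).
Proof.
move=> [mf [M fM]] [mg [N gN]]; split; first exact: measurable_funM.
by exists (M * N) => x; rewrite normrM ler_pM.
Qed.

Lemma bounded_rvZ c f : bounded_rv f -> bounded_rv (fun x => c * f x).
Proof. by move=> bf; apply: bounded_rvM => //; exact: bounded_rv_cst. Qed.

Lemma bounded_rv_expR f : bounded_rv f -> bounded_rv (fun x => expR (f x)).
Proof.
move=> [mf [M fM]]; split.
  exact: measurableT_comp.
exists (expR M) => x; rewrite ger0_norm ?expR_ge0 // ler_expR.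
by apply: le_trans (fM x); exact: ler_norm.
Qed.

Lemma bounded_rv_indic (A : set T) : measurable A -> bounded_rv (\1_A : T -> R).
Proof.
move=> mA; split; first exact: measurable_indic.
by exists 1 => x; rewrite indicE; case: (_ \in _); rewrite ?normr1 ?normr0.
Qed.

Lemma expect_cst c : expect (fun=> c) = c.
Proof.
rewrite /expect Rintegral_cst //.
rewrite [X in fine X](_ : _ = 1%E) ?mulr1 //; exact: probability_setT.
Qed.

Lemma expectD f g : bounded_rv f -> bounded_rv g ->
  expect (fun x => f x + g x) = expect f + expect g.
Proof.
by move=> bf bg; rewrite /expect RintegralD //; exact: bounded_rv_integrable.
Qed.

Lemma expectZ c f : bounded_rv f -> expect (fun x => c * f x) = c * expect f.
Proof.
by move=> bf; rewrite /expect RintegralZl //; exact: bounded_rv_integrable.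
Qed.

Lemma le_expect f g : bounded_rv f -> bounded_rv g -> (forall x, f x <= g x) ->
  expect f <= expect g.
Proof.
move=> bf bg fg; apply: le_Rintegral => //; exact: bounded_rv_integrable.
Qed.

Lemma expect_indic (A : set T) : measurable A -> (expect \1_A)%:E = P A.
Proof.
move=> mA; rewrite /expect /Rintegral.
have -> : (\int[P]_x (\1_A x : R)%:E = P A)%E by rewrite integral_indic // setIT.
by rewrite fineK // fin_num_measure.
Qed.

Lemma expectE f : bounded_rv f -> (expect f)%:E = (\int[P]_x (f x)%:E)%E.
Proof.
move=> bf; rewrite /expect /Rintegral fineK //.
exact: integrable_fin_num (bounded_rv_integrable bf).
Qed.

(** Replacing [g] by the maximum of [f] and [g] changes it on a null set only, which reduces to an
    inequality valid everywhere. *)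
Lemma ae_le_expect f g : bounded_rv f -> bounded_rv g ->
  {ae P, forall x, f x <= g x} -> expect f <= expect g.
Proof.
move=> bf bg [N [mN N0 sN]].
pose h x := Num.max (f x) (g x).
have bh : bounded_rv h.
  case: bf bg => mf [M fM] [mg [M' gM]]; split; first exact: measurable_maxr.
  exists (Num.max M M') => x; rewrite /h le_max.
  by case: (leP (f x) (g x)) => _; rewrite ?fM ?gM ?orbT.
apply: (@le_trans _ _ (expect h)).
  by apply: le_expect => // x; rewrite /h le_max lexx.
rewrite -lee_fin !expectE // le_eqVlt; apply/orP; left; apply/eqP.
apply: ae_eq_integral => //.
- by apply/measurable_EFinP; case: bh.
- by apply/measurable_EFinP; case: bg.
- exists N; split => // x /= hx; apply: sN => /= fg; apply: hx => _.
  by congr EFin; rewrite /h; apply/max_idPr.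
Qed.

Lemma chernoff f h : bounded_rv f ->
  (P [set x | (h <= f x)%R] <= (expR (- h) * expect (fun x => expR (f x)))%:E)%E.
Proof.
move=> bf; have mA : measurable [set x | h <= f x].
  have := @measurable_fun_ler _ _ _ setT (cst h) f (measurable_cst _) bf.1.
  move=> /(_ measurableT [set true] I); rewrite setTI.
  by congr measurable; apply/seteqP; split.
have be := bounded_rv_expR bf.
rewrite -(expect_indic mA) lee_fin -expectZ //.
apply: le_expect => [||x]; [exact: bounded_rv_indic|exact: bounded_rvZ|].
rewrite indicE; case: (boolP (x \in _)) => [|_]; last first.
  by rewrite mulr_ge0 ?expR_ge0.
by rewrite inE /= => hx; rewrite -expRD -expR0 ler_expR; lra.
Qed.

(** The joint law agrees with the product of the laws on rectangles, hence everywhere, and Tonelli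
    factorizes the integral. The absolute values in [nrm] and [k] make the integrands nonnegative on
    the whole line and plane. *)
Lemma expect_indep f g : bounded_rv f -> bounded_rv g ->
  (forall x, 0 <= f x) -> (forall x, 0 <= g x) ->
  (forall A B : set R, measurable A -> measurable B ->
    P (f @^-1` A `&` g @^-1` B) = (P (f @^-1` A) * P (g @^-1` B))%E) ->
  expect (fun x => f x * g x) = expect f * expect g.
Proof.
move=> bf bg f0 g0 fg.
pose F : {RV P >-> R} := mfun_Sub (mem_set bf.1).
pose G : {RV P >-> R} := mfun_Sub (mem_set bg.1).
have mH : measurable_fun [set: T] (fun x => (f x, g x)).
  by apply: measurable_fun_pair; [exact: bf.1|exact: bg.1].
pose H : {RV P >-> (R * R)%type} := mfun_Sub (mem_set mH).
pose nrm (x : R) := (`|x|)%:E.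
have mnrm : measurable_fun [set: R] nrm.
  by apply/measurable_EFinP; exact: normr_measurable.
have n0 y : (0 <= nrm y)%E by rewrite lee_fin.
pose k (z : R * R) := (`|z.1| * `|z.2|)%:E.
have mk : measurable_fun [set: R * R] k.
  apply/measurable_EFinP; apply: measurable_funM.
    by apply: measurableT_comp => //; exact: measurable_fst.
  by apply: measurableT_comp => //; exact: measurable_snd.
have HFG A : measurable A ->
    (distribution P F \x distribution P G)%E A = distribution P H A.
  apply: product_measure_unique => B C mB mC.
  rewrite /distribution /pushforward /= -fg //.
have e1 : (\int[distribution P H]_z k z =
    \int[(distribution P F \x distribution P G)%E]_z k z)%E.
  by apply: eq_measure_integral => A mA _; rewrite [RHS]HFG.
have k0 z : (0 <= k z)%E by rewrite lee_fin mulr_ge0.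
have eF : (\int[distribution P F]_x nrm x = \int[P]_x (f x)%:E)%E.
  rewrite (ge0_integral_distribution _ mnrm n0).
  by apply: eq_integral => x _; rewrite /nrm /= ger0_norm.
have eG : (\int[distribution P G]_x nrm x = \int[P]_x (g x)%:E)%E.
  rewrite (ge0_integral_distribution _ mnrm n0).
  by apply: eq_integral => x _; rewrite /nrm /= ger0_norm.
have eH : (\int[distribution P H]_x k x = \int[P]_x (f x * g x)%:E)%E.
  rewrite (ge0_integral_distribution _ mk k0).
  by apply: eq_integral => x _; rewrite /k /= !ger0_norm.
have := expectE (bounded_rvM bf bg) => /= efg.
apply: EFin_inj; rewrite EFinM efg !expectE //.
rewrite -eH e1 fubini_tonelli1 // /fubini_F /=.
under eq_integral => x _.
  under eq_integral do rewrite /k /= EFinM.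
  rewrite ge0_integralZl // eG -expectE //.
  over.
rewrite ge0_integralZr //; last first.
  by rewrite lee_fin Rintegral_ge0.
by rewrite eF expectE // expectE.
Qed.

End bounded_expectation.

(** * Functions of the past and independence of the next vector *)

Section past.
Context d d' (T : measurableType d) (T' : measurableType d') (R : realType)
  (P : probability T R) (X : nat -> T -> T').
Hypothesis mX : forall i, measurable_fun [set: T] (X i).
Hypothesis X_indep : mutually_independent P X.

Let box k (A : nat -> set T') : set T :=
  \bigcap_(i in [set i | (i < k)%N]) X i @^-1` A i.

Let boxes k : set (set T) :=
  [set B | exists2 A : nat -> set T', (forall i, measurable (A i)) & B = box k A].

(* [F] is a function of [X 0], ..., [X k.-1]. *)
Definition past k (F : T -> R) :=
  measurable_fun [set: g_sigma_algebraType (boxes k)]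
    (F : g_sigma_algebraType (boxes k) -> R).

Let mXA i A : measurable A -> measurable (X i @^-1` A).
Proof. by move=> mA; rewrite -[X in measurable X]setTI; exact: mX. Qed.

Let measurable_box k A : (forall i, measurable (A i)) -> measurable (box k A).
Proof. by move=> mA; apply: bigcap_measurableType => i _; exact: mXA. Qed.

Let initial k : {fset nat} := [fset i in iota 0 k]%fset.

Let box_initial k A :
  box k A = \bigcap_(i in [set` initial k]) X i @^-1` A i.
Proof.
apply/seteqP; split => x h i /=.
  by rewrite !inE mem_iota /= add0n; exact: h.
by move=> ik; apply: h; rewrite /= !inE mem_iota.
Qed.

Let box_indep k A C : (forall i, measurable (A i)) -> measurable C ->
  P (box k A `&` X k @^-1` C) = (P (box k A) * P (X k @^-1` C))%E.
Proof.
move=> mA mC; pose A' i := if i == k then C else A i.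
have mA' i : measurable (A' i) by rewrite /A'; case: ifP.
have -> : box k A `&` X k @^-1` C =
    \bigcap_(i in [set` (k |` initial k)%fset]) X i @^-1` A' i.
  apply/seteqP; split => x /=.
    move=> [h1 h2] i /=; rewrite in_fset1U => /orP[/eqP ->|].
      by rewrite /A' /= eqxx.
    rewrite !inE mem_iota /= add0n => ik; rewrite /A' (ltn_eqF ik).
    exact: h1.
  move=> h; split => [i /= ik|].
    have := h i; rewrite /= in_fset1U !inE mem_iota /= add0n ik orbT => /(_ isT).
    by rewrite /A' (ltn_eqF ik).
  by have := h k; rewrite /= in_fset1U eqxx => /(_ isT); rewrite /A' eqxx.
rewrite X_indep // big_fsetU1 /=; last by rewrite !inE mem_iota /= add0n ltnn.
rewrite box_initial X_indep // muleC {2}/A' eqxx; congr (_ * _)%E.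
rewrite big_seq [RHS]big_seq; apply: eq_bigr => i.
by rewrite !inE mem_iota /= add0n => ik; rewrite /A' (ltn_eqF ik).
Qed.

Let setI_closed_boxes k : setI_closed (boxes k).
Proof.
move=> B B' [A mA ->] [A' mA' ->]; exists (fun i => A i `&` A' i).
  by move=> i; exact: measurableI.
by rewrite /box -bigcapI; apply: eq_bigcapr => i _; rewrite preimage_setI.
Qed.

(** Dynkin's argument: independence from [X k] holds on the boxes, which are closed under
    intersection, and it defines a lambda-system. Measurability in [T] is carried along because
    membership in the generated sigma-algebra does not show it by itself. *)
Lemma past_indep k B C : <<s boxes k >> B -> measurable C ->
  measurable B /\ P (B `&` X k @^-1` C) = (P B * P (X k @^-1` C))%E.
Proof.
move=> sB mC; set D := X k @^-1` C.
have mD : measurable D by exact: mXA.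
pose H := [set B : set T | measurable B /\ P (B `&` D) = (P B * P D)%E].
suff : <<s boxes k >> `<=` H by move=> /(_ _ sB).
apply: lambda_system_subset => //.
- apply/dynkin_lambda_system; split => //.
  + by split => //; rewrite setTI probability_setT mul1e.
  + move=> A [mA PA]; split; first exact: measurableC.
    have fA : P A \is a fin_num by exact: fin_num_measure.
    have fD : P D \is a fin_num by exact: fin_num_measure.
    have e : P D = (P (D `\` A) + P (D `&` A))%E by exact: measureDI.
    rewrite probability_setC // muleBl ?fin_num_adde_defr // mul1e.
    rewrite [X in _ = (X - _)%E]e -PA (setIC D) -addeA subee ?adde0.
      by rewrite setIC setDE.
    by rewrite fin_num_measure //; exact: measurableI.
  + move=> F tF FH; split.
      by apply: bigcup_measurable => n _; exact: (FH n).1.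
    have mF n : measurable (F n) by exact: (FH n).1.
    have -> : P ((\bigcup_n F n) `&` D) = (\sum_(n <oo) P (F n `&` D))%E.
      rewrite setI_bigcupl measure_bigcup //.
      * by apply: eq_eseriesl => n; rewrite in_setT.
      * by move=> n _; exact: measurableI.
      * exact: trivIset_setIr.
    have -> : P (\bigcup_n F n) = (\sum_(n <oo) P (F n))%E.
      by rewrite measure_bigcup //; apply: eq_eseriesl => n; rewrite in_setT.
    have fD : P D = (fine (P D))%:E by rewrite fineK // fin_num_measure.
    rewrite muleC fD -nneseriesZl -?fD //.
    by apply: eq_eseriesr => n _; rewrite (FH n).2 muleC.
- by move=> _ [A mA ->]; split; [exact: measurable_box|exact: box_indep].
Qed.

Lemma past_measurable k F : past k F -> measurable_fun [set: T] F.
Proof.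
move=> pF _ A mA; have := pF measurableT A mA.
by rewrite !setTI => sF; have [] := past_indep sF measurableT.
Qed.

Lemma past_le k l F : (k <= l)%N -> past k F -> past l F.
Proof.
move=> kl pF _ A mA; have := pF measurableT A mA; apply: smallest_sub.
  exact: smallest_sigma_algebra.
move=> _ [B mB ->]; apply: sub_gen_smallest.
exists (fun i => if (i < k)%N then B i else setT).
  by move=> i; case: ifP.
apply/seteqP; split => x h i /= il.
  by case: ifP => // ik; exact: h.
by have := h i (leq_trans il kl); rewrite /= il.
Qed.

Lemma past_present k g : measurable_fun [set: T'] g -> past k.+1 (fun x => g (X k x)).
Proof.
move=> mg _ A mA; rewrite setTI; apply: sub_gen_smallest.
exists (fun i => if i == k then g @^-1` A else setT).
  move=> i; case: ifP => // _; rewrite -[X in measurable X]setTI; exact: mg.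
apply/seteqP; split => x /=.
  by move=> h i /= _; case: ifP => // /eqP ->.
by move=> /(_ k (ltnSn k)); rewrite eqxx.
Qed.

Lemma expect_past_mul k F (g : T' -> R) : past k F -> bounded_rv F ->
  measurable_fun [set: T'] g -> bounded_rv (fun x => g (X k x)) ->
  (forall x, 0 <= F x) -> (forall y, 0 <= g y) ->
  expect P (fun x => F x * g (X k x)) = expect P F * expect P (fun x => g (X k x)).
Proof.
move=> pF bF mg bg F0 g0; apply: expect_indep => // A B mA mB.
have mgB : measurable (g @^-1` B) by rewrite -[X in measurable X]setTI; exact: mg.
have sF : <<s boxes k >> (F @^-1` A).
  by have := pF measurableT A mA; rewrite setTI.
by have [_] := past_indep sF mgB.
Qed.

End past.

(** * Exponential bounds for the potential *)

Section exponential_moments.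
Context d (T : measurableType d) (R : realType) (P : probability T R).

(** Integrates [exp y <= 1 + y + 2 y^2], valid for [y <= 1/2]; the result is put in exponential form
    so that bounds multiply along the sites. *)
Lemma mgf_ub (f : T -> R) (t B : R) : bounded_rv f -> 0 <= t ->
  (forall x, `|f x| <= B) -> t * B <= 2^-1 ->
  expect P (fun x => expR (t * f x)) <=
  expR (t * expect P f + 2 * t ^+ 2 * B ^+ 2).
Proof.
move=> bf t0 fB tB.
have ub (x : T) : expR (t * f x) <= (1 + 2 * t ^+ 2 * B ^+ 2) + t * f x.
  have /ler_normlP[f1 f2] := fB x.
  have B0 : 0 <= B by exact: le_trans (normr_ge0 _) (fB x).
  set y := t * f x.
  have y1 : y <= 2^-1 by apply: le_trans tB; rewrite ler_wpM2l.
  have yB : y ^+ 2 <= t ^+ 2 * B ^+ 2.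
    rewrite /y exprMn ler_wpM2l ?sqr_ge0 //.
    by rewrite !expr2; nra.
  have h := expR_ge1Dx (- y).
  have e : expR y * expR (- y) = 1 by rewrite expRxMexpNx_1.
  have e0 := expR_gt0 y.
  (* [(1 - y) (1 + y + 2 y^2) >= 1] for [y <= 1/2] *)
  have h2 : expR y <= 1 + y + 2 * y ^+ 2.
    have h3 : expR y * (1 - y) <= 1 by rewrite -e ler_pM2l // addrC; lra.
    have y10 : 0 < 1 - y by lra.
    rewrite -(ler_pM2r y10); apply: le_trans h3 _.
    have : 0 <= y ^+ 2 * (1 - 2 * y) by rewrite mulr_ge0 ?sqr_ge0 //; lra.
    move=> h5; rewrite -subr_ge0.
    by rewrite (_ : _ - 1 = y ^+ 2 * (1 - 2 * y)) //; ring.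
  by lra.
have bu : bounded_rv (fun x => (1 + 2 * t ^+ 2 * B ^+ 2) + t * f x).
  by apply: bounded_rvD; [exact: bounded_rv_cst|exact: bounded_rvZ].
apply: (@le_trans _ _ (expect P (fun x => (1 + 2 * t ^+ 2 * B ^+ 2) + t * f x))).
  by apply: le_expect => //; apply: bounded_rv_expR; exact: bounded_rvZ.
rewrite expectD ?expect_cst ?expectZ //; [|exact: bounded_rv_cst|exact: bounded_rvZ].
by apply: le_trans (expR_ge1Dx _); lra.
Qed.

(** Squaring [exp (y / 2) >= 1 + y / 2], whose right side is nonnegative for [y >= -1], gives
    [exp y >= 1 + y + y^2 / 4]. The second moment is kept because it has to outweigh the negative
    drift. *)
Lemma mgf_lb (f : T -> R) (t B : R) : bounded_rv f -> 0 <= t ->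
  (forall x, `|f x| <= B) -> t * B <= 1 ->
  1 + t * expect P f + t ^+ 2 / 4 * expect P (fun x => f x ^+ 2) <=
  expect P (fun x => expR (t * f x)).
Proof.
move=> bf t0 fB tB.
have lb (x : T) : 1 + t * f x + t ^+ 2 / 4 * f x ^+ 2 <= expR (t * f x).
  have /ler_normlP[f1 f2] := fB x.
  set y := t * f x.
  have y1 : - 1 <= y.
    have : - y <= t * B by rewrite -mulrN ler_wpM2l.
    by move: (t * B) tB => z; lra.
  have -> : expR y = expR (y / 2) ^+ 2 by rewrite -expRM_natl; congr expR; field.
  have h := expR_ge1Dx (y / 2).
  apply: (@le_trans _ _ ((1 + y / 2) ^+ 2)).
    by rewrite /y le_eqVlt; apply/orP; left; apply/eqP; field.
  by rewrite ler_pXn2r ?nnegrE ?expR_ge0 //; lra.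
have bf2 : bounded_rv (fun x => f x ^+ 2) by exact: bounded_rvM.
have b1 : bounded_rv (fun x => 1 + t * f x).
  by apply: bounded_rvD; [exact: bounded_rv_cst|exact: bounded_rvZ].
have -> : 1 + t * expect P f + t ^+ 2 / 4 * expect P (fun x => f x ^+ 2) =
    expect P (fun x => 1 + t * f x + t ^+ 2 / 4 * f x ^+ 2).
  rewrite expectD //; last exact: bounded_rvZ.
  rewrite (expectZ P (t ^+ 2 / 4) bf2) expectD ?expect_cst ?expectZ //.
    exact: bounded_rv_cst.
  exact: bounded_rvZ.
apply: le_expect => //; first by apply: bounded_rvD => //; exact: bounded_rvZ.
by apply: bounded_rv_expR; exact: bounded_rvZ.
Qed.

Lemma measure_bigsetU_le (A : nat -> set T) n (y : R) :
  (forall i, measurable (A i)) -> (forall i, (P (A i) <= y%:E)%E) ->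
  (P (\big[setU/set0]_(i < n) A i) <= (n%:R * y)%:E)%E.
Proof.
move=> mA PA.
apply: le_trans (@Boole_inequality _ _ _ P A n (fun i _ => mA i)) _.
apply: (@le_trans _ _ (\sum_(i < n) y%:E)%E).
  by apply: lee_sum => i _; exact: PA.
by rewrite sumEFin sumr_const card_ord mulr_natl.
Qed.

End exponential_moments.

Section potential.
Context d d' (T : measurableType d) (T' : measurableType d') (R : realType)
  (P : probability T R) (X : nat -> T -> T') (h : nat -> T' -> R) (B : R).
Hypothesis mX : forall i, measurable_fun [set: T] (X i).
Hypothesis X_indep : mutually_independent P X.
Hypothesis mh : forall k, measurable_fun [set: T'] (h k).
Hypothesis hB : forall k y, `|h k y| <= B.
Hypothesis B0 : 0 < B.

Definition potential n (x : T) : R := \sum_(0 <= k < n) h k (X k x).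

Lemma potentialS n x : potential n.+1 x = potential n x + h n (X n x).
Proof. by rewrite /potential big_nat_recr. Qed.

Lemma bounded_rv_increment k : bounded_rv (fun x => h k (X k x)).
Proof.
split; first exact: measurableT_comp.
by exists B => x; exact: hB.
Qed.

Lemma past_potential n : past X n (potential n).
Proof.
elim: n => [|n IH].
  rewrite (_ : potential 0 = (fun=> 0)); first exact: measurable_cst.
  by apply/funext => x; rewrite /potential big_geq.
rewrite (_ : potential n.+1 = (fun x => potential n x + h n (X n x))).
  apply: measurable_funD; first exact: past_le IH.
  exact: past_present.
by apply/funext => x; rewrite potentialS.
Qed.

Lemma bounded_rv_potential n : bounded_rv (potential n).
Proof.
elim: n => [|n IH].
  rewrite (_ : potential 0 = (fun=> 0)); first exact: bounded_rv_cst.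
  by apply/funext => x; rewrite /potential big_geq.
rewrite (_ : potential n.+1 = (fun x => potential n x + h n (X n x))).
  by apply: bounded_rvD => //; exact: bounded_rv_increment.
by apply/funext => x; rewrite potentialS.
Qed.

Lemma potential_increment_le i j x : (i <= j)%N ->
  potential j x - potential i x <= (j - i)%:R * B.
Proof.
move=> ij; rewrite -{1}(subnKC ij); elim: (j - i)%N => [|l IH].
  by rewrite addn0 subrr mul0r.
rewrite addnS potentialS -natr1 mulrDl mul1r addrAC lerD //.
by apply: le_trans (hB (i + l)%N (X (i + l)%N x)); exact: ler_norm.
Qed.

Lemma mgf_potential t m i j : (i <= j)%N -> 0 <= m ->
  (forall k, (i <= k)%N -> (k < j)%N ->
    expect P (fun x => expR (t * h k (X k x))) <= m) ->
  expect P (fun x => expR (t * (potential j x - potential i x))) <= m ^+ (j - i).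
Proof.
move=> ij m0 hm; rewrite -{1}(subnKC ij).
have : (i + (j - i) <= j)%N by rewrite subnKC.
elim: (j - i)%N => [_|l IH lj].
  rewrite addn0 expr0 (_ : (fun x => _) = (fun=> 1)) ?expect_cst //.
  by apply/funext => x; rewrite subrr mulr0 expR0.
have {}IH := IH (leq_trans (leq_add (leqnn i) (leqnSn l)) lj).
have pV : past X (i + l) (potential i).
  by apply: past_le (@past_potential i); exact: leq_addr.
rewrite addnS in lj *.
rewrite (_ : (fun x => _) = (fun x =>
    expR (t * (potential (i + l) x - potential i x)) *
    expR (t * h (i + l)%N (X (i + l)%N x)))); last first.
  by apply/funext => x; rewrite -expRD potentialS; congr expR; ring.
rewrite (expect_past_mul mX X_indep (g := fun y => expR (t * h (i + l)%N y))) //.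
- rewrite exprSr; apply: ler_pM => //.
  + by apply: Rintegral_ge0 => x _; exact: expR_ge0.
  + by apply: Rintegral_ge0 => x _; exact: expR_ge0.
  + by apply: hm => //; exact: leq_addr.
- apply: measurableT_comp => //; apply: measurable_funM.
    exact: measurable_cst.
  apply: measurable_funB; first exact: past_potential.
  exact: pV.
- apply: bounded_rv_expR; apply: bounded_rvZ; apply: bounded_rvD.
    exact: bounded_rv_potential.
  rewrite (_ : (fun x => _) = (fun x => -1 * potential i x)).
    by apply: bounded_rvZ; exact: bounded_rv_potential.
  by apply/funext => x; rewrite mulN1r.
- by apply: measurableT_comp => //; apply: measurable_funM => //; exact: measurable_cst.
- by apply: bounded_rv_expR; apply: bounded_rvZ; exact: bounded_rv_increment.
Qed.

Lemma potential_tail t m i j y : (i <= j)%N -> 0 < t -> 0 <= m ->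
  (forall k, (i <= k)%N -> (k < j)%N ->
    expect P (fun x => expR (t * h k (X k x))) <= m) ->
  (P [set x | (y <= potential j x - potential i x)%R] <=
   (expR (- (t * y)) * m ^+ (j - i))%:E)%E.
Proof.
move=> ij t0 m0 hm.
have bV : bounded_rv (fun x => t * (potential j x - potential i x)).
  apply: bounded_rvZ; apply: bounded_rvD; first exact: bounded_rv_potential.
  rewrite (_ : (fun x => _) = (fun x => -1 * potential i x)).
    by apply: bounded_rvZ; exact: bounded_rv_potential.
  by apply/funext => x; rewrite mulN1r.
have := chernoff P (t * y) bV.
rewrite (_ : [set x | _] = [set x | y <= potential j x - potential i x]); last first.
  by apply/seteqP; split => x /=; rewrite ler_pM2l.
move=> H; apply: le_trans H _; rewrite lee_fin ler_wpM2l ?expR_ge0 //.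
exact: mgf_potential.
Qed.

Lemma measurable_potential_ge i j y :
  measurable [set x | y <= potential j x - potential i x].
Proof.
have mf : measurable_fun [set: T] (fun x => potential j x - potential i x).
  by apply: measurable_funB; [exact: (bounded_rv_potential j).1|exact: (bounded_rv_potential i).1].
have := measurable_fun_ler (measurable_cst y) mf.
move=> /(_ measurableT [set true] I); rewrite setTI.
by congr measurable; apply/seteqP; split.
Qed.

Section negative_drift.
Variables (alpha c : R) (k0 : nat).
Hypothesis alpha0 : 0 < alpha.
Hypothesis alpha12 : alpha < 2^-1.
Hypothesis c0 : 0 < c.
Hypothesis mean_le : forall k, (k0 <= k)%N ->
  expect P (fun x => h k (X k x)) <= - (c * k.+1%:R `^ (- alpha)).

(** The drift bound is weakest at the last site, which gives one estimate for all [k < N]. *)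
Let mgf_increment_le t N k : 0 <= t -> t * B <= 2^-1 -> (k0 <= k)%N -> (k < N)%N ->
  expect P (fun x => expR (t * h k (X k x))) <=
  expR (- (c * t * N%:R `^ (- alpha)) + 2 * t ^+ 2 * B ^+ 2).
Proof.
move=> t0 tB kk kN; have := mgf_ub P (bounded_rv_increment k) t0 (fun x => hB k (X k x)) tB.
move=> H; apply: le_trans H _; rewrite ler_expR lerD2r.
apply: (@le_trans _ _ (t * - (c * k.+1%:R `^ (- alpha)))).
  by rewrite ler_wpM2l // mean_le.
rewrite mulrN lerN2 mulrCA -mulrA; apply: ler_wpM2l; first exact: ltW.
apply: ler_wpM2l => //.
rewrite !powRN lef_pV2 ?posrE ?powR_gt0 ?ltr0n //; last exact: leq_trans kN.
by rewrite ge0_ler_powR ?nnegrE ?(ltW alpha0) // ler_nat.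
Qed.

Lemma potential_drawup_le : exists2 C, 0 < C &
  {ae P, forall x, \forall N \near \oo, forall i j, (i <= j)%N -> (j < N)%N ->
    potential j x - potential i x <= C * (N%:R `^ alpha * ln N%:R)}.
Proof.
(* Chosen so that [t * y N = 4 * ln N] for the [t] below: there are at most [N^2] pairs [i, j], and
   [N^-4] leaves [N^-2]. *)
pose C := 8 * B ^+ 2 / c.
have C0 : 0 < C by rewrite divr_gt0 // mulr_gt0 // exprn_gt0.
(* A climb that starts before [k0], where the drift is not controlled, is cut at [k0]; its first
   part is at most [k0 * B], eventually below [y N]. *)
exists (2 * C); first by rewrite mulr_gt0.
pose y N : R := C * (N%:R `^ alpha * ln N%:R).
pose A N i j := if [&& k0 <= i, i <= j & j < N]%N then
  [set x | y N <= potential j x - potential i x] else set0.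
have mA N i j : measurable (A N i j).
  by rewrite /A; case: ifP => _ //; exact: measurable_potential_ge.
have H := @borel_cantelli R _ _ P (fun N =>
  \big[setU/set0]_(i < N) \big[setU/set0]_(j < N) A N i j).
have {}H : {ae P, forall x, \forall N \near \oo,
    ~ (\big[setU/set0]_(i < N) \big[setU/set0]_(j < N) A N i j) x}.
  apply: H => [N|].
    by apply: bigsetU_measurable => i _; exact: bigsetU_measurable.
  near=> N.
  have N1 : 1 <= N%:R :> R by near: N; exact: near_nat_ge.
  have N0 : 0 < N%:R :> R by exact: lt_le_trans N1.
  have pN : 0 < N%:R `^ alpha :> R by rewrite powR_gt0.
  have NB : c / B <= N%:R `^ alpha by near: N; exact: near_powR_ge.
  (* The positive root of [- (c t N^(-alpha)) + 2 t^2 B^2 = 0]: each increment has exponential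
     moment at most 1, so the length of the stretch does not matter. *)
  pose t := c * N%:R `^ (- alpha) / (2 * B ^+ 2).
  have BB : 0 < 2 * B ^+ 2 by rewrite mulr_gt0 // exprn_gt0.
  have t0 : 0 < t by rewrite divr_gt0 // mulr_gt0 // powR_gt0.
  have tB : t * B <= 2^-1.
    have -> : t * B = c / B * (N%:R `^ alpha)^-1 / 2.
      by rewrite /t powRN; field; rewrite !gt_eqF.
    by rewrite ler_pdivrMr // mulVf ?lt0r_neq0 // ler_pdivrMr // mul1r.
  have PA i j : (P (A N i j) <= (expR (- (4 * ln N%:R)))%:E)%E.
    rewrite /A; case: ifPn => [/and3P[ki ij jN]|_]; last first.
      by rewrite measure0 lee_fin expR_ge0.
    have := @potential_tail t 1 i j (y N) ij t0 ler01 _.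
    move=> H; apply: le_trans (H _) _.
      move=> k ik kj; apply: le_trans (mgf_increment_le (N := N) (ltW t0) tB _ _) _.
      - exact: leq_trans ik.
      - exact: ltn_trans jN.
      rewrite (_ : - _ + _ = 0) ?expR0 //.
      by rewrite /t; field; rewrite gt_eqF.
    rewrite expr1n mulr1 lee_fin ler_expR lerN2 le_eqVlt; apply/orP; left; apply/eqP.
    by rewrite /t /y /C powRN; field; rewrite !gt_eqF.
  apply: le_trans (@measure_bigsetU_le _ _ _ P (fun i => \big[setU/set0]_(j < N) A N i j)
    N (N%:R * expR (- (4 * ln N%:R))) _ _) _.
  - by move=> i; exact: bigsetU_measurable.
  - by move=> i; apply: measure_bigsetU_le.
  rewrite lee_fin -{1 2}(lnK (_ : N%:R \is Num.pos)) ?posrE // -!expRD ler_expR.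
  by lra.
apply: filterS H => x hx; near=> N.
have hN : ~ (\big[setU/set0]_(i < N) \big[setU/set0]_(j < N) A N i j) x by near: N.
move=> i j ij jN.
have N1 : 1 <= N%:R :> R by near: N; exact: near_nat_ge.
have l1 : 1 <= ln N%:R :> R by near: N; exact: near_ln_ge.
have hk : k0%:R * B / C <= N%:R `^ alpha by near: N; exact: near_powR_ge.
have k0y : k0%:R * B <= y N.
  move: hk; rewrite ler_pdivrMr // => hk; apply: le_trans hk _.
  by rewrite /y mulrC ler_pM2l // ler_peMr // powR_ge0.
have main i' : (k0 <= i')%N -> (i' <= j)%N -> potential j x - potential i' x <= y N.
  move=> ki ij'; rewrite leNgt; apply/negP => hlt; apply: hN.
  rewrite -(bigcup_mkord _ (fun i => \big[setU/set0]_(j < N) A N i j)).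
  exists i' => /=; first exact: leq_ltn_trans jN.
  rewrite -(bigcup_mkord _ (fun j => A N i' j)); exists j => //=.
  by rewrite /A ki ij' jN /= ltW.
rewrite -mulrA -/(y N) mulr_natl mulr2n.
have y0 : 0 <= y N by rewrite mulr_ge0 ?(ltW C0) // mulr_ge0 ?powR_ge0 //; apply: le_trans l1.
have [ki|ik] := leqP k0 i.
  by apply: le_trans (main _ ki ij) _; rewrite lerDl.
have small i' j' : (i' <= j')%N -> (j' <= k0)%N -> potential j' x - potential i' x <= y N.
  move=> ij' jk; apply: le_trans (potential_increment_le x ij') _.
  by apply: le_trans k0y; rewrite ler_pM2r // ler_nat (leq_trans (leq_subr _ _)).
have [jk|kj] := leqP j k0.
  by apply: le_trans (small _ _ ij jk) _; rewrite lerDl.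
rewrite -(subrKA (potential k0 x)); apply: lerD; first by apply: main => //; exact: ltnW.
by apply: small => //; exact: ltnW.
Unshelve. all: end_near. Qed.

Lemma potential_drift : exists2 c2, 0 < c2 &
  {ae P, forall x, \forall a \near \oo,
    potential a.*2 x - potential a x <= - (c2 * a%:R `^ (1 - alpha))}.
Proof.
(* Between [a] and [2a] the mean fall is at least [c * b a * a]. A quarter of it is claimed, and
   [b a >= a^(-alpha) / 2] turns [c / 4] into [c / 8]. *)
exists (c / 8); first by rewrite divr_gt0.
pose b (a : nat) : R := a.*2%:R `^ (- alpha).
pose y a : R := - (c * b a * a%:R / 4).
pose A a := [set x | y a <= potential a.*2 x - potential a x].
have b_ge a : (0 < a)%N -> a%:R `^ (- alpha) / 2 <= b a.
  move=> a0; have ap : 0 < a%:R :> R by rewrite ltr0n.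
  rewrite /b -mul2n natrM powRM // mulrC ler_wpM2r ?powR_ge0 //.
  by rewrite -[leLHS]powR_inv1 // ler_powR ?ler1n //; move: alpha12; lra.
have H : {ae P, forall x, \forall a \near \oo, ~ A a x}.
  apply: borel_cantelli => [a|]; first exact: measurable_potential_ge.
  have h12 : 0 < 1 - 2 * alpha by move: alpha12; lra.
  pose q := c ^+ 2 / (64 * B ^+ 2).
  have q0 : 0 < q by rewrite divr_gt0 ?mulr_gt0 ?exprn_gt0.
  near=> a.
  have a0 : (0 < a)%N by near: a; exact: nbhs_infty_gt.
  have ka : (k0 <= a)%N by near: a; exact: nbhs_infty_ge.
  have ap : 0 < a%:R :> R by rewrite ltr0n.
  have b0 : 0 < b a by rewrite powR_gt0 // ltr0n double_gt0.
  have NB : c / B <= a%:R `^ alpha by near: a; exact: near_powR_ge.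
  (* The minimizer of the moment exponent [- (c t b) + 2 t^2 B^2]. *)
  pose t := c * b a / (4 * B ^+ 2).
  have t0 : 0 < t by rewrite divr_gt0 ?mulr_gt0 // exprn_gt0.
  have bB : c * b a <= B.
    have : b a <= (a%:R `^ alpha)^-1.
      rewrite /b powRN lef_pV2 ?posrE ?powR_gt0 // ?ltr0n ?double_gt0 //.
      by rewrite ge0_ler_powR ?nnegrE ?(ltW alpha0) // ler_nat -addnn leq_addl.
    rewrite -(ler_pM2l c0) => h1; apply: le_trans h1 _.
    by rewrite ler_pdivrMr ?powR_gt0 // mulrC -ler_pdivrMr.
  have tB : t * B <= 2^-1.
    have -> : t * B = (c * b a) / (4 * B) by rewrite /t; field; rewrite gt_eqF.
    rewrite ler_pdivrMr ?mulr_gt0 //; apply: le_trans bB _.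
    by have := B0; lra.
  have aa : (a <= a.*2)%N by rewrite -addnn leq_addl.
  pose m := expR (- (c * t * b a) + 2 * t ^+ 2 * B ^+ 2).
  have := @potential_tail t m a a.*2 (y a) aa t0 (expR_ge0 _) _.
  move=> H; apply: le_trans (H _) _.
    move=> k ak ka2; apply: mgf_increment_le => //; first exact: ltW.
    exact: leq_trans ak.
  rewrite -addnn addnK lee_fin /m -expRM_natl -expRD ler_expR.
  have -> : - (t * y a) + a%:R * (- (c * t * b a) + 2 * t ^+ 2 * B ^+ 2) =
      - (c ^+ 2 / (16 * B ^+ 2) * (b a ^+ 2 * a%:R)).
    by rewrite /t /y; field; rewrite gt_eqF.
  rewrite lerN2.
  have : 2 / q * ln a%:R <= a%:R `^ (1 - 2 * alpha) by near: a; exact: near_ln_le_powR.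
  rewrite mulrAC ler_pdivrMr // => hq; apply: le_trans hq _.
  have -> : a%:R `^ (1 - 2 * alpha) = (a%:R `^ (- alpha)) ^+ 2 * a%:R :> R.
    rewrite -[X in _ = _ * X](powRr1 (ltW ap)) expr2 -!powRD ?(gt_eqF ap) ?implybT //.
    by congr (_ `^ _); ring.
  have -> : c ^+ 2 / (16 * B ^+ 2) = q * 4 by rewrite /q; field; rewrite gt_eqF.
  rewrite [leLHS]mulrC -mulrA ler_pM2l // mulrA ler_wpM2r //.
  have := b_ge a a0; have := powR_ge0 a%:R (- alpha).
  by move: (_ `^ _) (b a) => u z u0 uz; rewrite !expr2; nra.
apply: filterS H => x hx; apply: filterS2 (nbhs_infty_gt 0) hx => a a0 hx.
have {}hx : potential a.*2 x - potential a x < y a by rewrite ltNge; apply/negP.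
apply: le_trans (ltW hx) _; rewrite lerN2.
have ap : 0 < a%:R :> R by rewrite ltr0n.
have -> : a%:R `^ (1 - alpha) = a%:R `^ (- alpha) * a%:R :> R.
  by rewrite -[X in _ * X](powRr1 (ltW ap)) -powRD ?(gt_eqF ap) ?implybT // addrC.
have := ler_wpM2l (ltW (mulr_gt0 c0 ap)) (b_ge a a0).
by move: (_ `^ _) (b a) => u z; lra.
Unshelve. all: end_near. Qed.

End negative_drift.
End potential.

(** * Existence of a high climb of the potential *)

Section drawup.
Context d d' (T : measurableType d) (T' : measurableType d') (R : realType)
  (P : probability T R) (X : nat -> T -> T') (h : nat -> T' -> R) (B : R).
Hypothesis mX : forall i, measurable_fun [set: T] (X i).
Hypothesis X_indep : mutually_independent P X.
Hypothesis mh : forall k, measurable_fun [set: T'] (h k).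
Hypothesis hB : forall k y, `|h k y| <= B.
Hypothesis B0 : 0 < B.

Let bW k : bounded_rv (fun x => h k (X k x)) := bounded_rv_increment mX mh hB k.

(* The largest draw-up of the potential that ends at [m + l], frozen once it
   exceeds the level [y]. *)
Fixpoint frozen_drawup m y l (x : T) : R :=
  if l is l'.+1 then
    let s := frozen_drawup m y l' x in
    if s <= y then Num.max (s + h (m + l')%N (X (m + l')%N x)) 0 else s
  else 0.

Lemma frozen_drawup_ge0 m y l x : 0 <= frozen_drawup m y l x.
Proof.
by elim: l => [|l IH] //=; case: ifP => // _; rewrite le_max lexx orbT.
Qed.

Lemma frozen_drawup_le m y l x : frozen_drawup m y l x <= l%:R * B.
Proof.
elim: l => [|l IH] /=; first by rewrite mul0r.
have hx : h (m + l)%N (X (m + l)%N x) <= B by apply: le_trans (ler_norm _) (hB _ _).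
rewrite -natr1 mulrDl mul1r; case: ifP => _; last first.
  by apply: le_trans IH _; rewrite lerDl ltW.
by rewrite ge_max lerD //= addr_ge0 ?mulr_ge0 // ltW.
Qed.

Lemma past_frozen_drawup m y l : past X (m + l) (frozen_drawup m y l).
Proof.
elim: l => [|l IH]; first exact: measurable_cst.
have IH' : past X (m + l.+1) (frozen_drawup m y l).
  by apply: past_le IH; rewrite leq_add2l.
apply: measurable_fun_ifT => //.
  by apply: measurable_fun_ler => //; exact: measurable_cst.
apply: measurable_maxr; last exact: measurable_cst.
by apply: measurable_funD => //; rewrite addnS; exact: past_present.
Qed.

Lemma bounded_rv_frozen_drawup m y l : bounded_rv (frozen_drawup m y l).
Proof.
split.
  apply: (past_measurable mX X_indep); exact: past_frozen_drawup.
exists (l%:R * B) => x.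
by rewrite ger0_norm ?frozen_drawup_ge0 ?frozen_drawup_le.
Qed.

(** As long as no climb exceeds [y] the recursion is never frozen and gives the height above the
    running minimum, attained at [i]. Read backwards, a value above [y] exhibits a genuine climb. *)
Lemma frozen_drawupE m y l x :
  (forall i j, (m <= i)%N -> (i <= j)%N -> (j <= m + l)%N ->
    potential X h j x - potential X h i x <= y) ->
  exists2 i, (m <= i <= m + l)%N &
    frozen_drawup m y l x = potential X h (m + l) x - potential X h i x.
Proof.
elim: l => [|l IH] H.
  by exists m; rewrite /= ?addn0 ?leqnn // subrr.
have [i j mi ij jl|i /andP[mi il] e] := IH.
  by apply: H => //; rewrite addnS ltnW.
have sy : frozen_drawup m y l x <= y by rewrite e; apply: H => //; rewrite addnS.
rewrite /= sy e; case: leP => _.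
  by exists (m + l.+1)%N; rewrite ?leqnn ?leq_addr // subrr.
exists i; first by rewrite mi addnS ltnW.
by rewrite addnS potentialS; ring.
Qed.

Section contraction.
Variables (m L : nat) (y t kappa : R).
Hypothesis y0 : 0 <= y.
Hypothesis t0 : 0 < t.
Hypothesis kappa0 : 0 <= kappa.
Hypothesis mgf_ge : forall k, (m <= k)%N -> (k < m + L)%N ->
  1 + kappa <= expect P (fun x => expR (t * h k (X k x))).

(** Freezing occurs at the first value above [y], which overshoots by at most [B], so [M] bounds the
    exponential of the draw-up at all times. *)
Let M := expR (t * (y + B)).
Let alive l x : R := ((frozen_drawup m y l x <= y)%R)%:R.
Let expS l x := expR (t * frozen_drawup m y l x).

Let alive_indic l : alive l = \1_[set x | frozen_drawup m y l x <= y].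
Proof.
apply/funext => x; rewrite indicE /alive; congr (_%:R).
by case: (boolP (_ <= y)) => hx; [rewrite mem_set|rewrite memNset //; apply/negP].
Qed.

Let measurable_alive l : measurable [set x | frozen_drawup m y l x <= y].
Proof.
have := measurable_fun_ler (bounded_rv_frozen_drawup m y l).1 (measurable_cst y).
move=> /(_ measurableT [set true] I); rewrite setTI.
by congr measurable; apply/seteqP; split.
Qed.

Let bA l : bounded_rv (alive l).
Proof. by rewrite alive_indic; exact: bounded_rv_indic. Qed.

Let bE l : bounded_rv (expS l).
Proof. by apply: bounded_rv_expR; apply: bounded_rvZ; exact: bounded_rv_frozen_drawup. Qed.

Let past_alive_exp l : past X (m + l) (fun x => alive l x * expS l x).
Proof.
have pS := @past_frozen_drawup m y l.
apply: measurable_funM.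
  rewrite (_ : alive l = (fun x => if frozen_drawup m y l x <= y then 1 else 0)).
    apply: measurable_fun_ifT.
    - by apply: measurable_fun_ler => //; exact: measurable_cst.
    - exact: measurable_cst.
    - exact: measurable_cst.
  by apply/funext => x; rewrite /alive; case: (_ <= y).
by apply: measurableT_comp => //; apply: measurable_funM => //; exact: measurable_cst.
Qed.

Let u l := expect P (fun x => alive l x * (M - expS l x)).

Let bu l : bounded_rv (fun x => alive l x * (M - expS l x)).
Proof.
apply: bounded_rvM => //; apply: bounded_rvD; first exact: bounded_rv_cst.
rewrite (_ : (fun x => _) = (fun x => -1 * expS l x)); first exact: bounded_rvZ.
by apply/funext => x; rewrite mulN1r.
Qed.

Let M_gt0 : 0 < M := expR_gt0 _.

Let u_ge0 l : 0 <= u l.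
Proof.
apply: Rintegral_ge0 => x _; rewrite /alive.
case: (leP (frozen_drawup m y l x) y) => hx; rewrite ?mul0r //.
rewrite mul1r subr_ge0 ler_expR ler_pM2l //; apply: le_trans hx _.
by rewrite lerDl ltW.
Qed.

(** While the process is alive its exponential gains a factor [1 + kappa] in mean, and the
    reflection at 0 only helps. The gain [kappa * q] is at least [kappa / M * u l], because [expS]
    is at least 1 and the gap to [M] is at most [M]. *)
Let u_step l : (l < L)%N -> u l.+1 <= u l - kappa / M * u l.
Proof.
move=> lL.
pose w x := expR (t * h (m + l)%N (X (m + l)%N x)).
have bw : bounded_rv w by apply: bounded_rv_expR; exact: bounded_rvZ.
have bAE : bounded_rv (fun x => alive l x * expS l x) by exact: bounded_rvM.
have bAEw : bounded_rv (fun x => alive l x * expS l x * w x) by exact: bounded_rvM.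
have bMA : bounded_rv (fun x => M * alive l x) by exact: bounded_rvZ.
have e1 : u l.+1 <= expect P (fun x => M * alive l x + -1 * (alive l x * expS l x * w x)).
  apply: le_expect => [||x]; first exact: bu.
    by apply: bounded_rvD => //; exact: bounded_rvZ.
  rewrite /alive /expS /w /=; case: (leP (frozen_drawup m y l x) y) => hs; last first.
    by rewrite (lt_geF hs) !(mulr0, mul0r, addr0).
  set s := frozen_drawup m y l x in hs *; set z := h _ _.
  rewrite mul1r mulr1 -expRD -mulrDr mulN1r.
  have zB : z <= B by apply: le_trans (ler_norm _) (hB _ _).
  have mle : Num.max (s + z) 0 <= y + B.
    by rewrite ge_max lerD // addr_ge0 // ltW.
  apply: (@le_trans _ _ (M - expR (t * Num.max (s + z) 0))).
    rewrite ler_piMl // ?lern1 ?leq_b1 //.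
    by rewrite subr_ge0 ler_expR ler_pM2l.
  by rewrite lerD2l lerN2 ler_expR ler_pM2l // le_max lexx.
have e2 : expect P (fun x => alive l x * expS l x * w x) =
    expect P (fun x => alive l x * expS l x) * expect P w.
  apply: (expect_past_mul mX X_indep (g := fun z => expR (t * h (m + l)%N z))) => //.
  - by apply: measurableT_comp => //; apply: measurable_funM => //; exact: measurable_cst.
  - by move=> x; rewrite mulr_ge0 ?expR_ge0 // ler0n.
have e3 : u l = M * expect P (alive l) - expect P (fun x => alive l x * expS l x).
  rewrite -mulN1r -!expectZ // -expectD //; last exact: bounded_rvZ.
  by congr expect; apply/funext => x; ring.
rewrite expectD ?expectZ // ?e2 in e1; last exact: bounded_rvZ.
set q := expect P (fun x => alive l x * expS l x) in e1 e3.
have q0 : 0 <= q.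
  by apply: Rintegral_ge0 => x _; rewrite mulr_ge0 ?expR_ge0 // ler0n.
have uq : u l / M <= q.
  rewrite mulrC -expectZ //; apply: le_expect => // [|x]; first exact: bounded_rvZ.
  rewrite mulrCA ler_wpM2l ?ler0n // mulrC ler_pdivrMr //.
  have E1 : 1 <= expS l x.
    by rewrite /expS -[leLHS]expR0 ler_expR mulr_ge0 ?(ltW t0) // frozen_drawup_ge0.
  have := M_gt0; move: (expS l x) E1 => z z1 Mp; nra.
have hw : 1 + kappa <= expect P w.
  by apply: mgf_ge; rewrite ?leq_addr // ltn_add2l.
apply: le_trans e1 _; rewrite mulN1r e3.
have h1 : q * (1 + kappa) <= q * expect P w by rewrite ler_wpM2l.
have h2 : kappa * (u l / M) <= kappa * q by rewrite ler_wpM2l.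
have -> : kappa / M * (M * expect P (alive l) - q) = kappa * (u l / M).
  by rewrite e3; ring.
by move: (M * _) (q * expect P w) (kappa * (u l / M)) h1 h2 => a b' c'; lra.
Qed.

(** By [u_step] the mean gap [u] decays geometrically; on survival up to [L] the gap is at least
    [exp (t (y + B)) - exp (t y) >= t B], which turns the decay into a bound on the survival
    probability. *)
Lemma frozen_drawup_small_probability :
  (P [set x | (frozen_drawup m y L x <= y)%R] <=
   (expR (t * (y + B)) / (t * B) *
    expR (- (kappa * L%:R / expR (t * (y + B)))))%:E)%E.
Proof.
have uL l : (l <= L)%N -> u l <= M * expR (- (kappa / M)) ^+ l.
  elim: l => [_|l IH lL].
    rewrite expr0 mulr1 -[leRHS](expect_cst P).
    apply: le_expect => // [|x]; first exact: bounded_rv_cst.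
    rewrite /alive /expS /= y0 mul1r mulr0 expR0.
    by rewrite gerBl.
  apply: le_trans (u_step lL) _.
  rewrite exprS mulrCA; apply: (@le_trans _ _ (expR (- (kappa / M)) * u l)).
    have -> : u l - kappa / M * u l = (1 + - (kappa / M)) * u l by ring.
    by apply: ler_wpM2r; [exact: u_ge0|exact: expR_ge1Dx].
  by rewrite ler_wpM2l ?expR_ge0 // IH // ltnW.
have tB0 : 0 < t * B by rewrite mulr_gt0.
rewrite -(expect_indic _ (measurable_alive L)) lee_fin -/M mulrAC ler_pdivlMr //.
apply: le_trans (_ : u L <= _).
  rewrite mulrC -expectZ; last exact: bounded_rv_indic.
  apply: le_expect => // [|x]; first by apply: bounded_rvZ; exact: bounded_rv_indic.
  rewrite -alive_indic mulrC /alive.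
  case: (leP (frozen_drawup m y L x) y) => hs; rewrite ?mul0r // !mul1r.
  rewrite lerBrDr; apply: (@le_trans _ _ (t * B + expR (t * y))).
    by rewrite lerD2l ler_expR ler_pM2l.
  rewrite /M mulrDr expRD.
  have h1 := expR_ge1Dx (t * B).
  have h2 : 1 <= expR (t * y) by rewrite -[leLHS]expR0 ler_expR mulr_ge0 // ltW.
  move: (expR (t * B)) (expR (t * y)) h1 h2 => a b' h1 h2.
  by move: (t * B) tB0 h1 => z z0 h1; nra.
apply: le_trans (uL L (leqnn L)) _; rewrite -expRM_natl.
by rewrite ler_pM2l // ler_expR le_eqVlt; apply/orP; left; apply/eqP; ring.
Qed.

End contraction.

Lemma potential_drawup_ge alpha c v k0 :
  0 < alpha -> alpha < 2^-1 -> 0 < c -> 0 < v ->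
  (forall k, (k0 <= k)%N ->
    - (c * k.+1%:R `^ (- alpha)) <= expect P (fun x => h k (X k x))) ->
  (forall k, (k0 <= k)%N -> v <= expect P (fun x => h k (X k x) ^+ 2)) ->
  exists2 c3, 0 < c3 & {ae P, forall x, \forall n \near \oo, exists i j,
    [/\ (n./2 <= i)%N, (i <= j)%N, (j < n)%N &
      c3 * n%:R `^ alpha <= potential X h j x - potential X h i x]}.
Proof.
move=> alpha0 alpha12 c0 v0 mean_ge sqr_ge.
(* Solves [K v / 4 = 2 c + 1]: for [t = K g] and a mean of at least [- 2 c g], the gain [t^2 v / 4]
   exceeds the loss [2 c g t] by exactly [K g^2], the [kappa] used below. *)
pose K := (8 * c + 4) / v.
have K0 : 0 < K by rewrite divr_gt0 // addr_gt0 // mulr_gt0.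
exists K^-1; first by rewrite invr_gt0.
pose y n : R := K^-1 * n%:R `^ alpha.
(* The window from [n./2] to [n.-1] lies beyond [k0], ends below [n] and has at least [n / 4]
   steps. *)
pose L n := (n.-1 - n./2)%N.
have H : {ae P, forall x, \forall n \near \oo,
    ~ [set x | frozen_drawup n./2 (y n) (L n) x <= y n] x}.
  have h12 : 0 < 1 - 2 * alpha by move: alpha12; lra.
  pose E2 : R := expR 2.
  have E20 : 0 < E2 by exact: expR_gt0.
  apply: borel_cantelli => [n|].
    have := measurable_fun_ler (bounded_rv_frozen_drawup n./2 (y n) (L n)).1 (measurable_cst (y n)).
    move=> /(_ measurableT [set true] I); rewrite setTI.
    by congr measurable; apply/seteqP; split.
  near=> n.
  have n4 : (4 <= n)%N by near: n; exact: nbhs_infty_ge.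
  have nk0 : (k0.*2.+1 <= n)%N by near: n; exact: nbhs_infty_ge.
  have n0 : 0 < n%:R :> R by rewrite ltr0n; exact: leq_trans n4.
  have pn : 0 < n%:R `^ alpha :> R by rewrite powR_gt0.
  have KB : K * B <= n%:R `^ alpha by near: n; exact: near_powR_ge.
  have l1 : 1 <= ln n%:R :> R by near: n; exact: near_ln_ge.
  have hK : ((5 + (K * B)^-1) * (4 * E2) / K) * ln n%:R <= n%:R `^ (1 - 2 * alpha).
    by near: n; exact: near_ln_le_powR.
  pose g : R := n%:R `^ (- alpha).
  have g0 : 0 < g by rewrite powR_gt0.
  have gp : g * n%:R `^ alpha = 1 by rewrite /g powRN mulVf // gt_eqF.
  pose t := K * g.
  have t0 : 0 < t by rewrite mulr_gt0.
  (* The level is matched to [t], so [exp (t (y + B))] stays below the constant [E2] and the decay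
     is governed by [kappa * L], of order [n^(1 - 2 alpha)]. *)
  have ty : t * y n = 1.
    by rewrite /t /y mulrACA mulfV ?gt_eqF // mul1r.
  have tB : t * B <= 1.
    by rewrite -gp /t mulrAC mulrC ler_pM2l.
  have y0 : 0 <= y n by rewrite mulr_ge0 ?invr_ge0 ?powR_ge0 // ltW.
  have nL : n%:R / 4 <= (L n)%:R :> R.
    rewrite ler_pdivrMr // -natrM ler_nat /L; move: n4; clear; lia.
  have kap0 : 0 <= K * g ^+ 2 by rewrite mulr_ge0 ?sqr_ge0 // ltW.
  have mgf k : (n./2 <= k)%N -> (k < n./2 + L n)%N ->
      1 + K * g ^+ 2 <= expect P (fun x => expR (t * h k (X k x))).
    move=> nk _.
    have kk0 : (k0 <= k)%N.
      by apply: leq_trans nk; rewrite -(doubleK k0) half_leq // ltnW.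
    apply: le_trans (mgf_lb P (bW k) (ltW t0) (fun x => hB k (X k x)) tB).
    have gk : k.+1%:R `^ (- alpha) <= 2 * g.
      rewrite /g !powRN -[leRHS]invrK invfM invrK lef_pV2 ?posrE ?powR_gt0 ?mulr_gt0 ?invr_gt0 ?ltr0n //.
      rewrite mulrC ler_pdivrMr //.
      apply: (@le_trans _ _ ((2 * k.+1%:R) `^ alpha)).
        rewrite ge0_ler_powR ?nnegrE ?mulr_ge0 ?(ltW alpha0) //.
        rewrite -natrM ler_nat; move: nk; clear; lia.
      rewrite powRM // mulrC ler_wpM2l ?powR_ge0 //.
      by rewrite -[leRHS]powRr1 // ler_powR ?ler1n //; move: alpha12; lra.
    have h1 : - (c * (2 * g)) <= expect P (fun x => h k (X k x)).
      by apply: le_trans (mean_ge k kk0); rewrite lerN2 ler_pM2l.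
    have h2 : t * - (c * (2 * g)) <= t * expect P (fun x => h k (X k x)).
      by rewrite ler_pM2l.
    have h3 : t ^+ 2 / 4 * v <= t ^+ 2 / 4 * expect P (fun x => h k (X k x) ^+ 2).
      by rewrite ler_wpM2l ?sqr_ge0 // ?divr_ge0 ?sqr_ge0 // sqr_ge.
    have e : K * g ^+ 2 = t * - (c * (2 * g)) + t ^+ 2 / 4 * v.
      by rewrite /t /K; field; rewrite gt_eqF.
    by move: (t * expect _ _) (t ^+ 2 / 4 * expect _ _) h2 h3 e => a b' *; lra.
  apply: le_trans (frozen_drawup_small_probability y0 t0 kap0 mgf) _.
  rewrite lee_fin mulrDr ty.
  have MM : expR (1 + t * B) <= E2 by rewrite ler_expR; move: tB; lra.
  have tB0 : 0 <= t * B by rewrite mulr_ge0 // ltW.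
  have kb0 : 0 <= (K * B)^-1 by rewrite invr_ge0; apply: mulr_ge0; exact: ltW.
  have e1 : (t * B)^-1 <= expR ((K * B)^-1) * expR (ln n%:R).
    have -> : (t * B)^-1 = (K * B)^-1 * n%:R `^ alpha.
      by rewrite /t /g powRN; field; rewrite !gt_eqF.
    apply: ler_pM; [exact: kb0|exact: powR_ge0| |].
      by apply: le_trans (expR_ge1Dx _); rewrite lerDr.
    rewrite lnK ?posrE // -[leRHS](powRr1 (ltW n0)) ler_powR //; last by move: alpha12; lra.
    by rewrite ler1n; exact: leq_trans n4.
  have e2 : K * g ^+ 2 * n%:R / (4 * E2) <= K * g ^+ 2 * (L n)%:R / expR (1 + t * B).
    have -> : K * g ^+ 2 * n%:R / (4 * E2) = K * g ^+ 2 * (n%:R / 4 / E2).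
      by field; rewrite gt_eqF.
    rewrite -[leRHS]mulrA; apply: ler_wpM2l => //; apply: ler_pM => //.
    - by rewrite invr_ge0 ltW.
    - by rewrite lef_pV2 ?posrE ?expR_gt0.
  apply: (@le_trans _ _ ((E2 * (expR ((K * B)^-1) * expR (ln n%:R))) *
      expR (- (K * g ^+ 2 * n%:R / (4 * E2))))).
    apply: ler_pM; [by rewrite divr_ge0 // expR_ge0|exact: expR_ge0| |].
      by apply: ler_pM MM e1; [exact: expR_ge0|rewrite invr_ge0].
    by rewrite ler_expR lerN2.
  rewrite /E2 -!expRD ler_expR -/E2.
  have -> : K * g ^+ 2 * n%:R / (4 * E2) = K / (4 * E2) * n%:R `^ (1 - 2 * alpha).
    have -> : n%:R `^ (1 - 2 * alpha) = g ^+ 2 * n%:R.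
      rewrite /g -[X in _ = _ * X](powRr1 (ltW n0)) expr2 -!powRD ?(gt_eqF n0) ?implybT //.
      by congr (_ `^ _); ring.
    by ring.
  have h4 : (5 + (K * B)^-1) * ln n%:R <= K / (4 * E2) * n%:R `^ (1 - 2 * alpha).
    have kp : 0 < K / (4 * E2) by rewrite divr_gt0 // mulr_gt0.
    apply: le_trans (_ : K / (4 * E2) * (((5 + (K * B)^-1) * (4 * E2) / K) * ln n%:R) <= _).
      by rewrite le_eqVlt; apply/orP; left; apply/eqP; field; rewrite !gt_eqF.
    by rewrite ler_pM2l.
  by move: (K / (4 * E2) * _) (K * B)^-1 (ln n%:R) h4 l1 kb0 => a b' l *; nra.
apply: filterS H => x hx; near=> n.
have hn : ~ [set x | frozen_drawup n./2 (y n) (L n) x <= y n] x by near: n.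
have n4 : (4 <= n)%N by near: n; exact: nbhs_infty_ge.
have mL : (n./2 + L n = n.-1)%N by rewrite /L; move: n4; clear; lia.
apply: contrapT => hex; apply: hn => /=.
have hV i j : (n./2 <= i)%N -> (i <= j)%N -> (j <= n./2 + L n)%N ->
    potential X h j x - potential X h i x <= y n.
  move=> ni ij; rewrite mL => jn; rewrite leNgt; apply/negP => hlt; apply: hex.
  exists i, j; split => //; last exact: ltW.
  by apply: leq_ltn_trans jn _; rewrite prednK //; exact: leq_trans n4.
have [i /andP[ni il] ->] := frozen_drawupE hV.
by apply: hV.
Unshelve. all: end_near. Qed.

End drawup.

(** * Increments of the potential *)

Section logit.
Context (R : realType).
Implicit Types x u delta : R.

Definition logit x : R := ln (x / (1 - x)).

Lemma ln_le_sub1 x : 0 < x -> ln x <= x - 1.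
Proof.
by move=> x0; have := expR_ge1Dx (ln x); rewrite lnK ?posrE // => h; rewrite lerBrDl.
Qed.

Lemma logit_compl x : 0 < x < 1 -> logit (1 - x) = - logit x.
Proof.
move=> /andP[x0 x1]; have y0 : 0 < 1 - x by rewrite subr_gt0.
rewrite /logit (_ : 1 - (1 - x) = x); last by ring.
by rewrite -lnV ?posrE ?divr_gt0 // invf_div.
Qed.

(** [ln z <= z - 1] applied to two ratios; the error is [u^2 / ((1 - x) (1 - x - u))], whose
    denominator is at least [delta * (delta / 2)]. *)
Lemma logit_perturb_le delta x u : 0 < delta -> delta <= x <= 1 - delta ->
  `|u| <= delta / 2 ->
  logit (x + u) - logit x <= u / (x * (1 - x)) + 2 / delta ^+ 2 * u ^+ 2.
Proof.
move=> d0 /andP[x1 x2] /ler_normlP[u1 u2].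
have x0 : 0 < x by lra.
have y0 : 0 < 1 - x by lra.
have xu0 : 0 < x + u by lra.
have yu0 : 0 < 1 - (x + u) by lra.
have e : logit (x + u) - logit x = ln ((x + u) / x) + ln ((1 - x) / (1 - (x + u))).
  rewrite /logit !ln_div ?posrE //; ring.
have h1 : ln ((x + u) / x) <= u / x.
  apply: le_trans (ln_le_sub1 _) _; first by rewrite divr_gt0.
  by rewrite le_eqVlt; apply/orP; left; apply/eqP; field; rewrite gt_eqF.
have h2 : ln ((1 - x) / (1 - (x + u))) <= u / (1 - (x + u)).
  apply: le_trans (ln_le_sub1 _) _; first by rewrite divr_gt0.
  by rewrite le_eqVlt; apply/orP; left; apply/eqP; field; rewrite gt_eqF.
have e2 : u / x + u / (1 - (x + u)) =
    u / (x * (1 - x)) + u ^+ 2 / ((1 - x) * (1 - (x + u))).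
  by field; rewrite !gt_eqF.
rewrite e; apply: le_trans (lerD h1 h2) _; rewrite e2 lerD2l mulrC.
rewrite ler_wpM2r ?sqr_ge0 //.
have -> : 2 / delta ^+ 2 = (delta * (delta / 2))^-1 by field; rewrite gt_eqF.
rewrite lef_pV2 ?posrE ?mulr_gt0 ?divr_gt0 //.
by apply: ler_pM; lra.
Qed.

(** The symmetry [logit (1 - x) = - logit x] turns the upper bound at [1 - x] and [- u] into this
    one. *)
Lemma logit_perturb_ge delta x u : 0 < delta -> delta <= x <= 1 - delta ->
  `|u| <= delta / 2 ->
  u / (x * (1 - x)) - 2 / delta ^+ 2 * u ^+ 2 <= logit (x + u) - logit x.
Proof.
move=> d0 /andP[x1 x2] uu; have /ler_normlP[u1 u2] := uu.
have := @logit_perturb_le delta (1 - x) (- u) d0 _ _.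
have -> : 1 - x + - u = 1 - (x + u) by ring.
rewrite !logit_compl; try (apply/andP; split; lra).
rewrite normrN sqrrN => /(_ _ uu).
have -> : delta <= 1 - x <= 1 - delta by apply/andP; split; lra.
move=> /(_ isT).
rewrite (_ : 1 - (1 - x) = x); last by ring.
rewrite mulNr (mulrC (1 - x)).
by move: (u / _) (2 / _ * _) (logit _) (logit _) => a b l l'; lra.
Qed.

Lemma logit_norm_le delta x : 0 < delta -> delta <= 1 -> delta / 2 <= x <= 1 - delta / 2 ->
  `|logit x| <= ln (2 / delta).
Proof.
move=> d0 d1 /andP[x1 x2].
have x0 : 0 < x by lra.
have y0 : 0 < 1 - x by lra.
have dd : 0 < 2 / delta by rewrite divr_gt0.
rewrite ler_norml -lnV ?posrE // invf_div /logit !ler_ln ?posrE ?divr_gt0 //.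
apply/andP; split; first by rewrite ler_pdivlMr //; nra.
rewrite ler_pdivrMr // (_ : 2 / delta * (1 - x) = (2 * (1 - x)) / delta); last by ring.
by rewrite ler_pdivlMr //; nra.
Qed.

Lemma logit_eq0 x : 0 < x < 1 -> logit x = 0 -> x = 2^-1.
Proof.
move=> /andP[x0 x1] /eqP; have y0 : 0 < 1 - x by lra.
rewrite ln_eq0 ?divr_gt0 // => /eqP h.
have : x / (1 - x) * (1 - x) = x by rewrite mulfVK // gt_eqF.
by rewrite h; lra.
Qed.

Lemma truncate_itv (a b x : R) : a <= b -> a <= truncate a b x <= b.
Proof.
move=> ab; rewrite /truncate; case: ltP => [_|ax]; first by rewrite lexx.
by case: ltP => [_|xb]; rewrite ?ab ?lexx // ax xb.
Qed.

Lemma truncate_id (a b x : R) : a <= x <= b -> truncate a b x = x.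
Proof. by move=> /andP[ax xb]; rewrite /truncate ltNge ax /= ltNge xb. Qed.

Lemma measurable_inv : measurable_fun [set: R] (fun x : R => x^-1).
Proof.
rewrite (_ : (fun x => _) = (fun x : R => x * (`|x| `^ (-1) * `|x| `^ (-1)))).
  have mp : measurable_fun [set: R] (fun x : R => `|x| `^ (-1)).
    rewrite (_ : (fun x => _) = (fun y : R => y `^ (-1)) \o (fun y : R => `|y|)) //.
    by apply: measurableT_comp; [exact: measurable_powR|exact: normr_measurable].
  by apply: measurable_funM => //; exact: measurable_funM.
apply/funext => x; rewrite !powR_inv1 ?normr_ge0 //.
have [->|x0] := eqVneq x 0; first by rewrite invr0 mul0r.
rewrite -invfM -expr2 real_normK ?num_real //.
by field.
Qed.

Lemma measurable_truncate (a b : R) : measurable_fun [set: R] (truncate a b).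
Proof.
apply: measurable_fun_ifT.
- by apply: measurable_fun_ltr => //; exact: measurable_cst.
- exact: measurable_cst.
- apply: measurable_fun_ifT => //.
  by apply: measurable_fun_ltr => //; exact: measurable_cst.
Qed.

Lemma measurable_logit : measurable_fun [set: R] logit.
Proof.
apply: (measurableT_comp (@measurable_ln R)).
apply: measurable_funM => //.
apply: (measurableT_comp measurable_inv).
by apply: measurable_funB => //; exact: measurable_cst.
Qed.

End logit.

Lemma expect_identically_distributed d d' (T : measurableType d)
    (T' : measurableType d') (R : realType) (P : probability T R)
    (X : nat -> T -> T') (g : T' -> R) i j :
  (forall k, measurable_fun [set: T] (X k)) ->
  identically_distributed P X -> measurable_fun [set: T'] g ->
  (exists M, forall y, `|g y| <= M) ->
  expect P (fun x => g (X i x)) = expect P (fun x => g (X j x)).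
Proof.
move=> mX idX mg [M gM].
have bg k : bounded_rv (fun x => g (X k x)).
  by split; [exact: measurableT_comp|exists M].
pose Y k : {RV P >-> T'} := mfun_Sub (mem_set (mX k)).
have e k : (\int[distribution P (Y k)]_y (g y)%:E = \int[P]_x (g (X k x))%:E)%E.
  rewrite integral_distribution //; first by apply/measurable_EFinP.
  exact: (bounded_rv_integrable P (bg k)).
apply: EFin_inj; rewrite !expectE // -!e.
by apply: eq_measure_integral => A mA _; exact: idX.
Qed.

(** * Moments of the increments in the random environment *)

Section environment_potential.
Context (R : realType) (d : measure_display) (Omega : measurableType d)
  (PP : probability Omega R) (delta alpha : R) (xi Y : nat -> {RV PP >-> R}).
Hypothesis delta0 : 0 < delta.
Hypothesis delta12 : delta < 2^-1.
Hypothesis Hiid : iid PP (fun (i : nat) (w : Omega) => (xi i.+1 w, Y i.+1 w)).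
Hypothesis Hxi : PP [set w | delta <= xi 1%N w <= 1 - delta] = 1%E.
Hypothesis HY : PP [set w | -1 <= Y 1%N w <= 1] = 1%E.
Hypothesis Hzeta : ('E_PP[zeta xi 1] = 0)%E.
Hypothesis Hs : (0 < 'V_PP[xi 1%N])%E.
Hypothesis Hlambda : ('E_PP[Zdrift xi Y 1] < 0)%E.
Hypothesis alpha0 : 0 < alpha.
Hypothesis alpha12 : alpha < 2^-1.

Let X i w : R * R := (xi i.+1 w, Y i.+1 w).

Definition increment (k : nat) (z : R * R) : R :=
  logit (truncate (delta / 2) (1 - delta / 2)
    (z.1 + z.2 * k.+1%:R `^ (- alpha))).

Let B := ln (2 / delta).

(* Versions of the limiting increment and of the drift coefficient that are
   bounded everywhere, not only almost surely. *)
Let cx (z : R * R) := truncate delta (1 - delta) z.1.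
Let cy (z : R * R) := truncate (-1) 1 z.2.
Let z0 z := logit (cx z).
Let zd z := cy z / (cx z * (1 - cx z)).

Let mX i : measurable_fun [set: Omega] (X i).
Proof. by apply: measurable_fun_pair; exact: measurable_funPT. Qed.

Let mcx : measurable_fun [set: R * R] cx.
Proof. by apply: measurableT_comp; [exact: measurable_truncate|exact: measurable_fst]. Qed.

Let mcy : measurable_fun [set: R * R] cy.
Proof. by apply: measurableT_comp; [exact: measurable_truncate|exact: measurable_snd]. Qed.

Let mz0 : measurable_fun [set: R * R] z0.
Proof. by apply: measurableT_comp mcx; exact: measurable_logit. Qed.

Let mzd : measurable_fun [set: R * R] zd.
Proof.
apply: measurable_funM => //.
apply: (measurableT_comp (@measurable_inv R)); apply: measurable_funM => //.
by apply: measurable_funB => //; exact: measurable_cst.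
Qed.

Let mincrement k : measurable_fun [set: R * R] (increment k).
Proof.
apply: (measurableT_comp (@measurable_logit R)).
apply: (measurableT_comp (measurable_truncate _ _)).
apply: measurable_funD; first exact: measurable_fst.
by apply: measurable_funM; [exact: measurable_snd|exact: measurable_cst].
Qed.

Let incrementB k z : `|increment k z| <= B.
Proof.
apply: logit_norm_le => //; first by move: delta12; lra.
by apply: truncate_itv; move: delta12; lra.
Qed.

Let cx_itv z : delta <= cx z <= 1 - delta.
Proof. by apply: truncate_itv; move: delta12; lra. Qed.

Let cy_itv z : -1 <= cy z <= 1.
Proof. by apply: truncate_itv; lra. Qed.

Let z0B z : `|z0 z| <= B.
Proof.
apply: logit_norm_le => //; first by move: delta12; lra.
by have /andP[a b] := cx_itv z; apply/andP; split; move: delta0; lra.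
Qed.

Let zdB z : `|zd z| <= (delta ^+ 2)^-1.
Proof.
have /andP[a b] := cx_itv z; have /andP[y1 y2] := cy_itv z.
have d0 := delta0.
have c0 : 0 < cx z * (1 - cx z) by rewrite mulr_gt0; lra.
rewrite /zd normrM -[leRHS]mul1r; apply: ler_pM => //.
  by rewrite ler_norml y1.
rewrite ger0_norm ?invr_ge0 ?(ltW c0) // lef_pV2 ?posrE ?exprn_gt0 //.
by rewrite expr2; apply: ler_pM; lra.
Qed.

Let B_gt0 : 0 < B.
Proof. by rewrite ln_gt0 // ltr_pdivlMr // mul1r; move: delta12; lra. Qed.

Let bounded_comp (g : R * R -> R) i M : measurable_fun [set: R * R] g ->
  (forall z, `|g z| <= M) -> bounded_rv (fun w => g (X i w)).
Proof. by move=> mg gM; split; [exact: measurableT_comp|exists M]. Qed.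

Let ae_itv (f : {RV PP >-> R}) (a b : R) :
  PP [set w | a <= f w <= b] = 1%E -> {ae PP, forall w, a <= f w <= b}.
Proof.
move=> H.
have e : [set w | a <= f w <= b] = f @^-1` `[a, b].
  by apply/seteqP; split => w /=; rewrite in_itv.
have mA : measurable [set w | a <= f w <= b].
  by rewrite e -[X in measurable X]setTI; exact: measurable_funPT.
exists (~` [set w | a <= f w <= b]); split => //; first exact: measurableC.
have H' := probability_setC PP mA; rewrite H subee // in H'.
Qed.

Let good : {ae PP, forall w, cx (X 0%N w) = xi 1%N w /\ cy (X 0%N w) = Y 1%N w}.
Proof.
apply: filterS2 (ae_itv Hxi) (ae_itv HY) => w h1 h2.
by rewrite /cx /cy !truncate_id.
Qed.

Let mean_z0 : expect PP (fun w => z0 (X 0%N w)) = 0.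
Proof.
have b := bounded_comp 0 mz0 z0B.
apply: EFin_inj; rewrite expectE //.
transitivity ('E_PP[zeta xi 1])%E; last by rewrite Hzeta.
rewrite unlock.
apply: ae_eq_integral => //.
- by apply/measurable_EFinP; exact: b.1.
- apply/measurable_EFinP; apply: (measurableT_comp (@measurable_logit R)).
  exact: measurable_funPT.
- by apply: filterS good => w [e _] _; rewrite /z0 e.
Qed.

Let lambda := expect PP (fun w => zd (X 0%N w)).

Let lambda_lt0 : lambda < 0.
Proof.
have b := bounded_comp 0 mzd zdB.
rewrite -lte_fin /lambda expectE //; apply: le_lt_trans Hlambda.
rewrite le_eqVlt unlock; apply/orP; left; apply/eqP.
apply: ae_eq_integral => //.
- by apply/measurable_EFinP; exact: b.1.
- apply/measurable_EFinP; apply: measurable_funM; first exact: measurable_funPT.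
  apply: (measurableT_comp (@measurable_inv R)).
  apply: measurable_funM; first exact: measurable_funPT.
  by apply: measurable_funB; [exact: measurable_cst|exact: measurable_funPT].
- by apply: filterS good => w [e1 e2] _; rewrite /zd e1 e2.
Qed.

Let sqr_mean := expect PP (fun w => z0 (X 0%N w) ^+ 2).

(** Non-degeneracy of [xi] enters here: if this second moment vanished, [logit] of [xi 1] would be 0
    almost surely, so [xi 1] would be the constant 1/2, with variance 0. *)
Let sqr_mean_gt0 : 0 < sqr_mean.
Proof.
have b := bounded_comp 0 mz0 z0B.
have b2 : bounded_rv (fun w => z0 (X 0%N w) ^+ 2) by exact: bounded_rvM.
rewrite lt0r andbC; apply/andP; split.
  by apply: Rintegral_ge0 => x _; exact: sqr_ge0.
apply/eqP => e0.
have e1 : (\int[PP]_w `|(z0 (X 0%N w) ^+ 2)%:E| = 0)%E.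
  under eq_integral do rewrite abse_EFin ger0_norm ?sqr_ge0 //.
  by rewrite -expectE // -/sqr_mean e0.
have m2 : measurable_fun [set: Omega] (fun w => (z0 (X 0%N w) ^+ 2)%:E).
  by apply/measurable_EFinP; exact: b2.1.
have /(ae_eq_integral_abs PP measurableT m2) ae0 := e1.
have half : {ae PP, forall w, xi 1%N w = 2^-1}.
  apply: filterS2 ae0 good => w h [e _]; rewrite -e.
  have /andP[c1 c2] := cx_itv (X 0%N w); have d0 := delta0.
  apply: logit_eq0; first by apply/andP; split; lra.
  have := h I; rewrite /cst => -[/eqP]; rewrite sqrf_eq0 => /eqP; exact.
have E1 : ('E_PP[xi 1%N] = (2^-1)%:E)%E.
  transitivity ((expect PP (fun=> 2^-1))%:E); last by rewrite expect_cst.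
  rewrite expectE; last exact: bounded_rv_cst.
  rewrite unlock.
  apply: ae_eq_integral => //.
  - by apply/measurable_EFinP; exact: measurable_funPT.
  - by apply: filterS half => w -> _.
have : ('V_PP[xi 1%N] = 0)%E.
  rewrite /variance covariance.unlock E1 expectation.unlock /=.
  have -> : (0 = \int[PP]_w 0%:E)%E by rewrite integral0.
  apply: ae_eq_integral => //.
  - apply/measurable_EFinP; apply: measurable_funM;
      by apply: measurable_funB; [exact: measurable_funPT|exact: measurable_cst].
  - apply: filterS half => w e _.
    change (((xi 1%N w - 2^-1) * (xi 1%N w - 2^-1))%:E = 0%:E :> \bar R).
    by rewrite e subrr mul0r.
by move=> V0; move: Hs; rewrite V0 ltxx.
Qed.

Let u k : R := k.+1%:R `^ (- alpha).

Let u_gt0 k : 0 < u k.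
Proof. by rewrite powR_gt0. Qed.

Let near_u (e : R) : 0 < e -> \forall k \near \oo, u k <= e.
Proof.
move=> e0; near=> k.
have h : e^-1 <= k%:R `^ alpha by near: k; exact: near_powR_ge.
rewrite /u powRN invf_ple ?posrE ?powR_gt0 //; apply: le_trans h _.
by rewrite ge0_ler_powR ?nnegrE ?(ltW alpha0) // ler_nat.
Unshelve. all: end_near. Qed.

(** Once [u k <= delta / 2] the truncation is almost surely inactive, and the perturbation bounds
    for [logit] apply with [|Y| <= 1]. *)
Let expansion : {ae PP, forall w, forall k, u k <= delta / 2 ->
  z0 (X 0%N w) + (u k * zd (X 0%N w) - 2 / delta ^+ 2 * u k ^+ 2) <=
    increment k (X 0%N w) /\
  increment k (X 0%N w) <=
  z0 (X 0%N w) + (u k * zd (X 0%N w) + 2 / delta ^+ 2 * u k ^+ 2)}.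
Proof.
apply: filterS good => w [ex ey] k uk.
have xI := cx_itv (X 0%N w); have /andP[x1 x2] := xI.
have yI := cy_itv (X 0%N w); have /andP[y1 y2] := yI.
have u0 := u_gt0 k.
have yu : `|cy (X 0%N w) * u k| <= delta / 2.
  rewrite normrM (ger0_norm (ltW u0)); apply: le_trans uk.
  by rewrite ler_piMl ?(ltW u0) // ler_norml.
have /ler_normlP[yu1 yu2] := yu.
have e : increment k (X 0%N w) = logit (cx (X 0%N w) + cy (X 0%N w) * u k).
  rewrite /increment /= ex ey -/(u k) truncate_id //.
  by rewrite -ex -ey; apply/andP; split; lra.
have ub := logit_perturb_le delta0 xI yu.
have lb := logit_perturb_ge delta0 xI yu.
have sq : (cy (X 0%N w) * u k) ^+ 2 <= u k ^+ 2.
  rewrite exprMn ler_piMl ?sqr_ge0 // -[leRHS](expr1n _ 2).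
  by rewrite !expr2; move: y1 y2; move: (cy _) => v; nra.
have q0 : 0 <= 2 / delta ^+ 2 by rewrite divr_ge0 // sqr_ge0.
have sq2 := ler_wpM2l q0 sq.
have ez : cy (X 0%N w) * u k / (cx (X 0%N w) * (1 - cx (X 0%N w))) =
    u k * zd (X 0%N w) by rewrite /zd; ring.
rewrite ez in ub lb; rewrite e /z0.
move: (2 / _ * _) (2 / _ * _) (u k * _) (logit _) (logit _) ub lb sq2.
by move=> a b c p q *; split; lra.
Qed.

Let bi k : bounded_rv (fun w => increment k (X 0%N w)).
Proof. exact: bounded_comp (incrementB k). Qed.

(** The moment hypotheses and the almost sure bounds concern site 1; equality in law moves every
    expectation there. *)
Let expect_increment k (g : R -> R) : measurable_fun [set: R] g ->
  (exists M, forall y, `|g (increment k y)| <= M) ->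
  expect PP (fun w => g (increment k (X k w))) =
  expect PP (fun w => g (increment k (X 0%N w))).
Proof.
move=> mg gM; apply: (@expect_identically_distributed _ _ _ _ _ PP X (fun z => g (increment k z)) k 0%N) => //.
  exact: Hiid.2.
by apply: measurableT_comp.
Qed.

Let bz0 : bounded_rv (fun w => z0 (X 0%N w)) := bounded_comp 0 mz0 z0B.
Let bzd : bounded_rv (fun w => zd (X 0%N w)) := bounded_comp 0 mzd zdB.

Let expect_affine a b : bounded_rv (fun w => z0 (X 0%N w) + (a * zd (X 0%N w) + b)) /\
  expect PP (fun w => z0 (X 0%N w) + (a * zd (X 0%N w) + b)) = a * lambda + b.
Proof.
have ba : bounded_rv (fun w => a * zd (X 0%N w)) by exact: bounded_rvZ.
have bb : bounded_rv (fun w : Omega => b) by exact: bounded_rv_cst.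
have bab : bounded_rv (fun w => a * zd (X 0%N w) + b) by exact: bounded_rvD.
split; first exact: bounded_rvD.
by rewrite expectD // expectD // expectZ // expect_cst mean_z0 add0r.
Qed.

Let mean_increment k : u k <= delta / 2 ->
  u k * lambda - 2 / delta ^+ 2 * u k ^+ 2 <= expect PP (fun w => increment k (X k w))
  /\ expect PP (fun w => increment k (X k w)) <= u k * lambda + 2 / delta ^+ 2 * u k ^+ 2.
Proof.
move=> uk; rewrite (@expect_increment k id) //; last by exists B.
have [b1 e1] := expect_affine (u k) (- (2 / delta ^+ 2 * u k ^+ 2)).
have [b2 e2] := expect_affine (u k) (2 / delta ^+ 2 * u k ^+ 2).
split.
  by rewrite -e1; apply: ae_le_expect => //; apply: filterS expansion => w /(_ k uk)[].
by rewrite -e2; apply: ae_le_expect => //; apply: filterS expansion => w /(_ k uk)[].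
Qed.

(** From [i^2 >= z^2 + 2 z (i - z)] with [|z| <= B] and [|i - z| <= 3 u / delta^2], where 3 adds 1
    for the drift term and 2 for the quadratic error. *)
Let sqr_increment k : u k <= delta / 2 ->
  sqr_mean - 2 * B * (3 / delta ^+ 2) * u k <= expect PP (fun w => increment k (X k w) ^+ 2).
Proof.
move=> uk; rewrite (@expect_increment k (fun y => y ^+ 2)); last 2 first.
- by apply: measurable_funM.
- by exists (B * B) => z; rewrite expr2 normrM ler_pM.
have b2 : bounded_rv (fun w => z0 (X 0%N w) ^+ 2) by exact: bounded_rvM.
have bc c : bounded_rv (fun w : Omega => c) by exact: bounded_rv_cst.
set c := 2 * B * _ * _.
have -> : sqr_mean - c = expect PP (fun w => z0 (X 0%N w) ^+ 2 + - c).
  by rewrite expectD // expect_cst.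
apply: ae_le_expect => //; first exact: bounded_rvD.
  exact: bounded_rvM.
apply: filterS expansion => w /(_ k uk)[h1 h2].
have u0 := u_gt0 k.
have u1 : u k <= 1 by apply: le_trans uk _; move: delta12; lra.
have dd : 0 < (delta ^+ 2)^-1 by rewrite invr_gt0 exprn_gt0.
have usq : u k ^+ 2 <= u k by rewrite expr2 ler_piMl // ltW.
have /ler_normlP[d1 d2] := zdB (X 0%N w).
have /ler_normlP[b1 b2'] := z0B (X 0%N w).
have Bp := B_gt0.
set dl := (delta ^+ 2)^-1 in dd d1 d2.
have k1 : u k * zd (X 0%N w) <= u k * dl by rewrite ler_pM2l.
have k2 : - (u k * dl) <= u k * zd (X 0%N w) by rewrite -mulrN ler_pM2l //; lra.
have k3 : 2 / delta ^+ 2 * u k ^+ 2 <= 2 / delta ^+ 2 * u k.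
  by rewrite ler_wpM2l // divr_ge0 // sqr_ge0.
have e1 : 2 / delta ^+ 2 * u k = 2 * (u k * dl) by rewrite /dl; ring.
have ec : c = 6 * B * (u k * dl) by rewrite /c /dl; ring.
rewrite e1 in k3; rewrite ec.
have ud : 0 < u k * dl by rewrite mulr_gt0.
move: (2 / _ * u k ^+ 2) (u k * zd _) (u k * dl) k1 k2 k3 ud h1 h2 => a b e k1 k2 k3 ud h1 h2.
have [l1 l2] : z0 (X 0%N w) - 3 * e <= increment k (X 0%N w) /\
    increment k (X 0%N w) <= z0 (X 0%N w) + 3 * e by split; lra.
move: (increment _ _) (z0 _) b1 b2' l1 l2 => i z *.
rewrite !expr2.
have : 0 <= (i - z) ^+ 2 by exact: sqr_ge0.
rewrite expr2 => isq.
have z1 : - (3 * e * B) <= z * (i - z).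
  have [zp|zn] := leP 0 z; last by nra.
  by nra.
by nra.
Qed.

Lemma environment_potential : exists C c2 c3, [/\ 0 < C, 0 < c2, 0 < c3 &
  {ae PP, forall w, [/\
    \forall N \near \oo, forall i j, (i <= j)%N -> (j < N)%N ->
      potential X increment j w - potential X increment i w <=
      C * (N%:R `^ alpha * ln N%:R),
    \forall a \near \oo, potential X increment a.*2 w - potential X increment a w <=
      - (c2 * a%:R `^ (1 - alpha)) &
    \forall n \near \oo, exists i j,
      [/\ (n./2 <= i)%N, (i <= j)%N, (j < n)%N &
        c3 * n%:R `^ alpha <= potential X increment j w - potential X increment i w]]}].
Proof.
have l0 := lambda_lt0; have d0 := delta0; have s0 := sqr_mean_gt0; have Bp := B_gt0.
have dd : 0 < 2 / delta ^+ 2 by rewrite divr_gt0 // exprn_gt0.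
have D0 : 0 < 2 * B * (3 / delta ^+ 2) by rewrite !mulr_gt0 // invr_gt0 exprn_gt0.
(* From [k0] on the quadratic error is at most half of the drift, so the mean lies between
   [2 lambda u] and [lambda u / 2], and the second moment keeps half of its limit. *)
have [k0 _ hk] : \forall k \near \oo, [/\ u k <= delta / 2,
    2 / delta ^+ 2 * u k <= - lambda / 2 &
    2 * B * (3 / delta ^+ 2) * u k <= sqr_mean / 2].
  near=> k; split; rewrite -?ler_pdivlMl //; near: k; apply: near_u.
  - by rewrite divr_gt0.
  - by rewrite mulr_gt0 ?invr_gt0 // divr_gt0 // oppr_gt0.
  - by rewrite mulr_gt0 ?invr_gt0 // divr_gt0.
have mean_le k : (k0 <= k)%N ->
    expect PP (fun w => increment k (X k w)) <= - (- lambda / 2 * k.+1%:R `^ (- alpha)).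
  move=> kk; have [u1 u2 u3] := hk k kk; have [_ h] := mean_increment u1.
  apply: le_trans h _; rewrite -/(u k) (expr2 (u k)) mulrA.
  have /= := ler_wpM2r (ltW (u_gt0 k)) u2.
  by lra.
have mean_ge k : (k0 <= k)%N ->
    - (- (2 * lambda) * k.+1%:R `^ (- alpha)) <= expect PP (fun w => increment k (X k w)).
  move=> kk; have [u1 u2 u3] := hk k kk; have [h _] := mean_increment u1.
  apply: le_trans h; rewrite -/(u k) (expr2 (u k)) mulrA.
  have /= := ler_wpM2r (ltW (u_gt0 k)) u2.
  have : 0 < u k * - lambda by rewrite mulr_gt0 ?u_gt0 // oppr_gt0.
  by lra.
have sqr_ge k : (k0 <= k)%N ->
    sqr_mean / 2 <= expect PP (fun w => increment k (X k w) ^+ 2).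
  move=> kk; have [u1 u2 u3] := hk k kk; have := sqr_increment u1.
  by move: (_ * u k) u3 => a; lra.
have c0 : 0 < - lambda / 2 by rewrite divr_gt0 // oppr_gt0.
have c0' : 0 < - (2 * lambda) by lra.
have v0 : 0 < sqr_mean / 2 by rewrite divr_gt0.
have [C C0 hC] := potential_drawup_le mX Hiid.1 mincrement incrementB B_gt0
  alpha0 c0 mean_le.
have [c2 c20 hc2] := potential_drift mX Hiid.1 mincrement incrementB B_gt0 alpha0 alpha12 c0 mean_le.
have [c3 c30 hc3] := potential_drawup_ge mX Hiid.1 mincrement incrementB B_gt0 alpha0 alpha12 c0' v0 mean_ge sqr_ge.
exists C, c2, c3; split => //.
by apply: filterS3 hC hc2 hc3 => w; split.
Unshelve. all: end_near. Qed.

End environment_potential.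

(** * Quenched bounds for almost every environment *)

Theorem theorem3 (R : realType) (d : measure_display) (Omega : measurableType d)
    (PP : probability Omega R) (delta alpha : R)
    (xi Y : nat -> {RV PP >-> R}) (r : nat)
    (hdelta : 0 < delta < 2^-1)
    (hiid : iid PP (fun (i : nat) (w : Omega) => (xi i.+1 w, Y i.+1 w)))
    (hxi : PP [set w | delta <= xi 1%N w <= 1 - delta] = 1%E)
    (hY : PP [set w | -1 <= Y 1%N w <= 1] = 1%E)
    (hzeta : ('E_PP[zeta xi 1] = 0)%E)
    (hs : (0 < 'V_PP[xi 1%N] < +oo)%E)
    (hlambda : ('E_PP[Zdrift xi Y 1] < 0)%E)
    (hsigma : (0 <= 'V_PP[Y 1%N] < +oo)%E)
    (halpha : 0 < alpha < 2^-1) :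
  {ae PP, forall w : Omega,
    forall (d' : measure_display) (T : measurableType d')
      (P : probability T R) (eta : nat -> {RV P >-> nat}),
    markov_chain (transition (environment delta alpha xi Y w)) r eta ->
    forall eps : R, 0 < eps ->
    {ae P, forall x : T, \forall t \near \oo,
      (ln (ln t%:R)) `^ (- (1 / alpha) - eps)
        < (eta t x)%:R / (ln t%:R) `^ (1 / alpha)
        < (ln (ln t%:R)) `^ (2 / alpha + eps)}}.
Proof.
have /andP[d0 d12] := hdelta; have /andP[a0 a12] := halpha.
have /andP[V0 _] := hs.
have [C [c2 [c3 [C0 c20 c30 H]]]] :=
  environment_potential d0 d12 hiid hxi hY hzeta V0 hlambda a0 a12.
(* The exceptional environments are those whose potential has the wrong shape, so one null set
   serves every walk and every [eps]. *)
apply: filterS H => w [H1 H2 H3] d' T P eta mc eps eps0.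
pose p := environment delta alpha xi Y w.
pose X i (v : Omega) : R * R := (xi i.+1 v, Y i.+1 v).
pose V n := potential X (increment delta alpha) n w.
have pS n : delta / 2 <= p n.+1 <= 1 - delta / 2 by apply: truncate_itv; lra.
have p01 n : 0 <= p n <= 1.
  case: n => [|n]; first by apply/andP; split; rewrite /p /=; lra.
  by have /andP[? ?] := pS n; apply/andP; split; lra.
have p1 n : p n < 1.
  case: n => [|n]; first by rewrite /p /=; lra.
  by have /andP[? ?] := pS n; lra.
have pQ n : (1 - p n)^-1 <= 2 / delta.
  rewrite -[2 / delta]invrK lef_pV2 ?posrE ?subr_gt0 ?invr_gt0 ?divr_gt0 // invf_div.
  case: n => [|n]; first by rewrite /p /=; lra.
  by have /andP[? ?] := pS n; lra.
have Vrec n : p n.+1 * expR (V n) = (1 - p n.+1) * expR (V n.+1).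
  have /andP[q1 q2] := pS n.
  have q0 : 0 < 1 - p n.+1 by rewrite subr_gt0.
  have q0' : 0 < p n.+1 by lra.
  rewrite /V potentialS expRD.
  (* Index [n] of the potential is site [n.+1] of the environment, in [X] as well as in [increment],
     so both sides compute to the same term. *)
  have -> : increment delta alpha n (X n w) = ln (p n.+1 / (1 - p n.+1)) by [].
  rewrite lnK ?posrE ?divr_gt0 //.
  by field; rewrite gt_eqF.
have lo := speed_lower p01 p1 pQ Vrec a0 a12 C0 c20 H1 H2 mc eps0.
have up := speed_upper p01 Vrec a0 a12 mc c30 H3 eps0.
apply: filterS2 lo up => x lo up; near=> t.
by apply/andP; split; near: t.
Unshelve. all: end_near. Qed.
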